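(* There exists a sequence of complex numbers $(c(n))_{n\ge 0}$ such that the power series $$F(z)=\sum_{n\ge 0} c(n)z^{n}$$ converges at almost every point of the circle $|z|=1$ to some function $f\in L^{2}(\mathbb{T})$ (that is, $\sum_{n\ge 0}c(n)e^{int}=f(t)$ for almost every $t\in\mathbb{T}$), and $f$ does not belong to the Hardy space $H^{2}$.
   Context: $\mathbb{T}=\mathbb{R}/2\pi\mathbb{Z}$ is identified with the unit circle $|z|=1$ via $z=e^{it}$; ''almost every'' refers to Lebesgue measure. A function $f$ on the circle is said to be in $H^{2}$ if it is the boundary limit of an $H^{2}$ function on the unit disk, or, equivalently, if $f\in L^{2}(\mathbb{T})$ and $\widehat{f}(-n)=0$ for all $n=1,2,\dots$, where $\widehat{f}(k)=\frac{1}{2\pi}\int_{0}^{2\pi}f(t)e^{-ikt}\,dt$ are the Fourier coefficients. *)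

(* Defs.v *)
From HB Require Import structures.
From mathcomp Require Import all_boot all_order all_algebra.
From mathcomp Require Import all_classical all_reals all_analysis.
From mathcomp Require Import complex.

Set Implicit Arguments.
Unset Strict Implicit.
Unset Printing Implicit Defensive.

Import Order.TTheory GRing.Theory Num.Theory.
Import numFieldNormedType.Exports.

Local Open Scope classical_set_scope.
Local Open Scope ring_scope.
Local Open Scope complex_scope.

(* A function on T = R / 2 pi Z, i.e. on the unit circle through z = e^(it),  *)
(* is a function f : R -> R[i] of the angle with [periodic f (2 * pi)];       *)
(* integrals and null sets on T are taken over one period.                    *)

Definition expi (R : realType) (t : R) : R[i] := cos t +i* sin t.

Definition cintegral (R : realType) (D : set R) (g : R -> R[i]) : R[i] :=
  (\int[lebesgue_measure]_(t in D) complex.Re (g t))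
  +i* (\int[lebesgue_measure]_(t in D) complex.Im (g t)).

(* Elements of L^2 are represented by actual functions, not by their a.e.     *)
(* classes, with measurability of the real and imaginary parts.               *)
Definition L2_circle (R : realType) (f : R -> R[i]) : Prop :=
  [/\ periodic f (2 * pi),
      measurable_fun `[0, 2 * pi] (fun t : R => complex.Re (f t)),
      measurable_fun `[0, 2 * pi] (fun t : R => complex.Im (f t)) &
      (\int[lebesgue_measure]_(t in `[0%R, (2 * pi)%R])
          (ComplexField.Normc.normc (f t) ^+ 2)%:E < +oo)%E].

Definition fourier_coef (R : realType) (f : R -> R[i]) (k : int) : R[i] :=
  ((2 * pi)^-1)%:C
  * cintegral `[0, 2 * pi] (fun t : R => f t * expi (- (k%:~R * t))).

Definition hardy2 (R : realType) (f : R -> R[i]) : Prop :=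
  L2_circle f
  /\ forall n : nat, (1 <= n)%N -> fourier_coef f (- n%:Z) = 0.

(* The alias R[i]^o carries the topology of the modulus on R[i].              *)
Definition power_series_cvg (R : realType) (c : nat -> R[i]) (z l : R[i]) :
    Prop :=
  series (fun n => c n * z ^+ n) @ \oo --> (l : R[i]^o).

(* Main.v *)
Require Import Defs.
From HB Require Import structures.
From mathcomp Require Import all_boot all_order all_algebra.
From mathcomp Require Import all_classical all_reals all_analysis.
From mathcomp Require Import complex.
From mathcomp Require Import measurable_realfun ring lra zify.

Import Order.TTheory GRing.Theory Num.Theory.
Import numFieldNormedType.Exports.

Local Open Scope classical_set_scope.
Local Open Scope ring_scope.

(** The power series is built in stages.  Stage n is a polynomial F_n, with
    values f_n(t) = F_n(e^(it)) on the circle, and the next one is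

      f_(n+1)(t) = f_n(t) (1 + w(t) G(t)),   G(t) = e^(iNt) Z(e^(iNt)),

    where w is a trigonometric polynomial with values in [0, rho_n], Z is a
    polynomial, and N is so large that the added terms have degree above that
    of F_n.  Hence each F_n is a partial sum of one power series.
    For large N the factor G behaves as if independent of everything built
    before, so along the stages f_n(t) behaves like a planar martingale with
    isotropic increments.  The weight w is a cutoff: it nearly vanishes where
    |f_n| <= 1/2 and is at least rho_n / 2 where |f_n| is a little larger.  So
    the walk starts near 1 and is stopped when it enters the disc of radius
    1/2.

    Stopping happens at almost every t ([active_small]), because planar
    Brownian motion is recurrent.  Quantitatively, the mean of ln |f_n|^2 does
    not grow and the mean of 1 / |f_n|^2 grows by about the mean of
    w^2 / |f_n|^2, both up to O(rho_n^3) ([incr_ln], [incr_inv]).  The second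
    mean is bounded, as |f_n| stays away from 0, so the total gain is finite;
    the first one prevents |f_n| from escaping to infinity on the set where
    the walk is still moving.  With rho_n of order 1 / sqrt n, the sum of
    rho_n^2 diverges while that of rho_n^3 converges, so this set shrinks to
    measure 0.

    Convergence of the whole series, and not only along the stages, comes from
    the choice of Z: it is a normalised Rudin-Shapiro polynomial
    ([flat_poly]), whose partial sums are bounded and whose coefficients are
    as small as desired compared with those of w F_n.  At a stopped point a
    partial sum inside a block therefore differs little from f_n(t)
    ([take_blocks], [refinement]).

    The limit f is bounded with |f| close to 1/2.  It is not in H^2, since its
    coefficient of index -1 does not vanish: f is close to conj(1/f) / 4, so
    this coefficient is close to a quarter of the conjugate of the coefficient
    of index 1 of 1/f.  The latter is almost preserved by every stage
    ([incr_coef]), because 1/f_n is multiplied by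
    1 / (1 + w G), whose oscillating terms average out, and it equals -1/4 for
    F_0 = 1 + z/4. *)

Set Implicit Arguments.
Unset Strict Implicit.
Unset Printing Implicit Defensive.

(** * Modulus and points of the circle *)

Notation normc := ComplexField.Normc.normc.
Notation Re := complex.Re.
Notation Im := complex.Im.
Notation "x %:C" := (real_complex _ x) (format "x %:C") : ring_scope.

Section Modulus.
Context {R : rcfType}.
Implicit Types (x y : R) (z w : R[i]).

Lemma ReD z w : Re (z + w) = Re z + Re w. Proof. by case: z w => ? ? []. Qed.
Lemma ImD z w : Im (z + w) = Im z + Im w. Proof. by case: z w => ? ? []. Qed.
Lemma ReN z : Re (- z) = - Re z. Proof. by case: z. Qed.
Lemma ImN z : Im (- z) = - Im z. Proof. by case: z. Qed.
Lemma ReM z w : Re (z * w) = Re z * Re w - Im z * Im w.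
Proof. by case: z w => ? ? []. Qed.
Lemma ImM z w : Im (z * w) = Re z * Im w + Im z * Re w.
Proof. by case: z w => ? ? []. Qed.
Lemma Re_conjc z : Re (conjc z) = Re z. Proof. by case: z. Qed.
Lemma Im_conjc z : Im (conjc z) = - Im z. Proof. by case: z. Qed.

Lemma normc_ge0 z : 0 <= normc z. Proof. by case: z => ? ?; exact: sqrtr_ge0. Qed.

Lemma normc_sqr z : normc z ^+ 2 = Re z ^+ 2 + Im z ^+ 2.
Proof. by case: z => a b /=; rewrite sqr_sqrtr ?addr_ge0 ?sqr_ge0. Qed.

Lemma ler_normcD z w : normc (z + w) <= normc z + normc w.
Proof. exact: (@le_normcD R z w). Qed.

Lemma normc_neg z : normc (- z) = normc z. Proof. exact: (@normcN R z). Qed.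

Lemma ler_normcB z w : normc z - normc w <= normc (z - w).
Proof. by rewrite lerBlDr (le_trans _ (ler_normcD _ _))// subrK. Qed.

Lemma normcBC z w : normc (z - w) = normc (w - z).
Proof. by rewrite -normc_neg opprB. Qed.

Lemma normcM z w : normc (z * w) = normc z * normc w.
Proof. exact: ComplexField.Normc.normcM. Qed.

Lemma normcV z : normc z^-1 = (normc z)^-1.
Proof. exact: ComplexField.Normc.normcV. Qed.

Lemma normc1 : normc (1 : R[i]) = 1. Proof. exact: ComplexField.Normc.normc1. Qed.

Lemma normc0 : normc (0 : R[i]) = 0. Proof. exact: ComplexField.Normc.normc0. Qed.

Lemma normcX z n : normc (z ^+ n) = normc z ^+ n.
Proof. by elim: n => [|n IH]; rewrite ?expr0 ?normc1// !exprS normcM IH. Qed.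

Lemma normc_real x : normc x%:C = `|x|.
Proof. by rewrite /= expr0n/= addr0 sqrtr_sqr. Qed.

Lemma normc_conj z : normc (conjc z) = normc z.
Proof. by case: z => a b /=; rewrite sqrrN. Qed.

Lemma normc_eq0 z : (normc z == 0) = (z == 0).
Proof.
apply/eqP/eqP => [/ComplexField.Normc.eq0_normc//|->].
exact: normc0.
Qed.

Lemma normc_gt0 z : (0 < normc z) = (z != 0).
Proof. by rewrite lt0r normc_eq0 normc_ge0 andbT. Qed.

Lemma Re_le z : `|Re z| <= normc z.
Proof. by case: z => a b /=; rewrite -sqrtr_sqr ler_wsqrtr// lerDl sqr_ge0. Qed.

Lemma Im_le z : `|Im z| <= normc z.
Proof. by case: z => a b /=; rewrite -sqrtr_sqr ler_wsqrtr// lerDr sqr_ge0. Qed.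

Lemma normc_le_ReIm z : normc z <= `|Re z| + `|Im z|.
Proof.
rewrite -(@ler_pXn2r _ 2)// ?nnegrE ?normc_ge0 ?addr_ge0//.
rewrite normc_sqr sqrrD !real_normK ?num_real// lerD2r lerDl.
by rewrite mulrn_wge0// mulr_ge0.
Qed.

Lemma normc_sum (I : Type) (r : seq I) (P : pred I) (F : I -> R[i]) :
  normc (\sum_(i <- r | P i) F i) <= \sum_(i <- r | P i) normc (F i).
Proof.
elim/big_ind2 : _ => // [|x1 y1 x2 y2 h1 h2].
  by rewrite normc0.
by rewrite (le_trans (ler_normcD _ _))// lerD.
Qed.

Lemma conjc_mul_self z : conjc z * z = (normc z ^+ 2)%:C.
Proof.
apply/eqP; rewrite eq_complex ReM ImM Re_conjc Im_conjc/= normc_sqr.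
by apply/andP; split; apply/eqP; ring.
Qed.

Lemma invc_conj z : z != 0 -> z^-1 = conjc z * ((normc z ^+ 2)^-1)%:C.
Proof.
move=> z0; apply: (mulfI z0); rewrite divff// mulrA [z * _]mulrC conjc_mul_self.
by rewrite -rmorphM/= divff ?rmorph1// expf_neq0// normc_eq0.
Qed.

End Modulus.

Section Expi.
Context {R : realType}.
Implicit Types (s t : R).

Lemma expi0 : expi (0 : R) = 1.
Proof. by rewrite /expi cos0 sin0. Qed.

Lemma expiD s t : expi (s + t) = expi s * expi t.
Proof.
by apply/eqP; rewrite eq_complex ReM ImM/= cosD sinD eqxx/= addrC mulrC addrC
  eqxx.
Qed.

Lemma expiX t n : expi t ^+ n = expi (t *+ n).
Proof.
by elim: n => [|n IH]; rewrite ?expr0 ?mulr0n ?expi0// exprS IH -expiD mulrS.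
Qed.

Lemma normc_expi t : normc (expi t) = 1.
Proof. by rewrite /= cos2Dsin2 sqrtr1. Qed.

Lemma expi_conjM t : conjc (expi t) * expi t = 1.
Proof. by rewrite conjc_mul_self normc_expi expr1n. Qed.

Lemma expi_periodic : periodic (@expi R) (2 * pi).
Proof.
by move=> t; rewrite /expi mulrC mulr_natr sinD2pi cosD2pi.
Qed.

End Expi.

(** * Third-order bounds for a small perturbation *)

Section Pointwise.
Context {R : realType}.

Lemma ln1D_le3 (x : R) : -1 < x -> ln (1 + x) <= x - x ^+ 2 / 2 + x ^+ 3 / 3.
Proof.
move=> x1.
pose g (y : R) := y - y ^+ 2 / 2 + y ^+ 3 / 3 - ln (1 + y).
have dg (y : R) : -1 < y -> is_derive y 1 g (y ^+ 3 / (1 + y)).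
  move=> y1; have y0 : 0 < 1 + y by lra.
  have : is_derive (1 + y) 1 (@ln R) (1 + y)^-1 by exact: is_derive1_ln.
  move=> ?; have : is_derive y 1 (fun z : R => ln (1 + z)) ((1 + y)^-1 * (0 + 1)).
    exact: (@is_derive1_comp _ (@ln R) (fun z => 1 + z)).
  move=> ?; apply: is_derive_eq.
  rewrite /GRing.scale/=; field; lra.
suff : 0 <= g x by rewrite /g subr_ge0.
have g0 : g 0 = 0 by rewrite /g addr0 ln1 !expr0n/=; ring.
have cg (y : R) : -1 < y -> {for y, continuous g}.
  move=> y1; apply: differentiable_continuous; apply/derivable1_diffP.
  by have [] := dg _ y1.
have cgw (a b : R) : -1 < a -> {within `[a, b], continuous g}.
  move=> a1; apply: continuous_in_subspaceT => y; rewrite inE/= in_itv/=.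
  by move=> /andP[ay _]; apply: cg; lra.
rewrite -g0; have [x0|x0] := leP 0 x.
  have [] := @MVT_segment R g (fun y => y ^+ 3 / (1 + y)) 0 x x0.
  - by move=> y; rewrite in_itv/= => /andP[y0 _]; apply: dg; lra.
  - by apply: cgw; lra.
  - move=> c; rewrite in_itv/= => /andP[c0 cx] e; rewrite -subr_ge0 e.
    by rewrite mulr_ge0 ?subr0// divr_ge0 ?exprn_ge0//; lra.
have [] := @MVT_segment R g (fun y => y ^+ 3 / (1 + y)) x 0 (ltW x0).
- by move=> y; rewrite in_itv/= => /andP[y0 _]; apply: dg; lra.
- exact: cgw.
- move=> c; rewrite in_itv/= => /andP[c0 cx] e; rewrite -subr_le0 e.
  rewrite sub0r mulr_le0_ge0//; last lra.
  rewrite mulr_le0_ge0//; last by rewrite invr_ge0; lra.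
  by rewrite exprn_odd_le0.
Qed.

(** Writing |1 + u|^2 = 1 + x reduces the bounds for the logarithm and for the
    inverse to one real variable; x has size 2 |u| at most up to second order,
    so x^3 is of order |u|^3. *)
Lemma normc1D_sqr (u : R[i]) : normc u <= 4^-1 ->
  exists x : R, [/\ normc (1 + u) ^+ 2 = 1 + x, x = 2 * Re u + normc u ^+ 2,
    0 < 1 + x, x ^+ 3 <= 12 * normc u ^+ 3 &
    4 * Re u ^+ 2 - 4 * normc u ^+ 3 <= x ^+ 2].
Proof.
have := normc_ge0 u; have := normc_sqr u; have := Re_le u.
move: (normc u) => y; rewrite normc_sqr.
case: u => a b/=; rewrite add0r => hay yab y0 y4.
pose x := 2 * a + y ^+ 2; exists x.
have xy : `|x| <= 9/4 * y.
  rewrite (le_trans (ler_normD _ _))// normrM (ger0_norm (ltW _))//.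
  rewrite (ger0_norm (sqr_ge0 _)).
  have : y ^+ 2 <= 4^-1 * y by rewrite expr2 ler_wpM2r.
  lra.
split => //.
- by rewrite /x yab; ring.
- by move: xy; rewrite ler_norml => /andP[h _]; lra.
- rewrite (le_trans (ler_norm _))// normrX.
  have : `|x| ^+ 3 <= (9/4 * y) ^+ 3 by rewrite lerXn2r// nnegrE ?mulr_ge0//; lra.
  rewrite exprMn => /le_trans; apply; rewrite ler_wpM2r ?exprn_ge0//; lra.
- have : `|a * y ^+ 2| <= y ^+ 3.
    by rewrite normrM (ger0_norm (sqr_ge0 _)) exprS ler_wpM2r ?sqr_ge0.
  have y4_0 : 0 <= y ^+ 4 by rewrite exprn_ge0.
  have -> : x ^+ 2 = 4 * a ^+ 2 + 4 * (a * y ^+ 2) + y ^+ 4 by rewrite /x; ring.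
  rewrite ler_norml => /andP[? _]; lra.
Qed.

Lemma Re_sqr (u : R[i]) : Re (u ^+ 2) = 2 * Re u ^+ 2 - normc u ^+ 2.
Proof. rewrite normc_sqr [u ^+ 2]expr2 ReM; ring. Qed.

(** The terms of second order on the right add up to - Re (u^2) alone: ln |1 +
    u| is harmonic, so |u|^2 cannot occur.  This is why isotropic increments
    do not increase the mean of the logarithm. *)
Lemma ln_normc1D (u : R[i]) : normc u <= 4^-1 ->
  ln (normc (1 + u) ^+ 2) <= 2 * Re u - Re (u ^+ 2) + 12 * normc u ^+ 3.
Proof.
move=> u4; have u3 := exprn_ge0 3 (normc_ge0 u).
have [x [-> xE x1 x3 x2]] := normc1D_sqr u4; rewrite Re_sqr.
have := @ln1D_le3 x; have -> : -1 < x by lra.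
move=> /(_ isT); lra.
Qed.

(** In contrast with the logarithm, |u|^2 survives with a positive sign: 1 /
    |1 + u|^2 is subharmonic. *)
Lemma inv_normc1D (u : R[i]) : normc u <= 4^-1 ->
  1 - 2 * Re u + normc u ^+ 2 + 2 * Re (u ^+ 2) - 16 * normc u ^+ 3
    <= (normc (1 + u) ^+ 2)^-1.
Proof.
move=> u4; have u3 := exprn_ge0 3 (normc_ge0 u).
have [x [-> xE x1 x3 x2]] := normc1D_sqr u4; rewrite Re_sqr.
suff : 1 - x + x ^+ 2 - x ^+ 3 <= (1 + x)^-1 by lra.
rewrite -[leRHS]mul1r ler_pdivlMr//.
have -> : (1 - x + x ^+ 2 - x ^+ 3) * (1 + x) = 1 - x ^+ 4 by ring.
by rewrite gerBl exprn_even_ge0.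
Qed.

Lemma Re_div1D (g u : R[i]) : normc u <= 4^-1 ->
  `|Re (g / (1 + u)) - Re (g * (1 - u + u ^+ 2))| <= 2 * normc g * normc u ^+ 3.
Proof.
move=> u4; have u1 : 2^-1 <= normc (1 + u).
  by have := ler_normcB 1 (- u); rewrite opprK normc1 normc_neg; lra.
have u0 : 1 + u != 0 by rewrite -normc_gt0; lra.
rewrite -ReN -ReD (le_trans (Re_le _))//.
have -> : g / (1 + u) - g * (1 - u + u ^+ 2) = - (g * u ^+ 3 / (1 + u)) by field.
rewrite normc_neg normcM [normc (g * _)]normcM normcX normcV ler_pdivrMr; last by lra.
have := mulr_ge0 (normc_ge0 g) (exprn_ge0 3 (normc_ge0 u)); nra.
Qed.

End Pointwise.

(** * Flat polynomials *)

Section Flat.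
Context {R : realType}.
Implicit Types (P Q : {poly R[i]}) (w : R[i]).

Lemma normc_parallelogram (p q : R[i]) :
  normc (p + q) ^+ 2 + normc (p - q) ^+ 2 = 2 * (normc p ^+ 2 + normc q ^+ 2).
Proof. rewrite !normc_sqr !ReD !ImD !ReN !ImN; ring. Qed.

Lemma normcD_sqr (p q : R[i]) :
  normc (p + q) ^+ 2 = normc p ^+ 2 + normc q ^+ 2 + 2 * Re (conjc p * q).
Proof. rewrite !normc_sqr !ReD !ImD ReM Re_conjc Im_conjc; ring. Qed.

(** Expanding the square of the modulus, the diagonal terms give the constant
    and the others come in conjugate pairs.  Multiplied by a trigonometric
    polynomial of small degree, the second term on the right has mean 0 at
    high frequency. *)
Lemma normc_horner_sqr P : exists Y : {poly R[i]}, forall w, normc w = 1 ->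
  normc P.[w] ^+ 2 = \sum_(i < size P) normc P`_i ^+ 2 + 2 * Re (w * Y.[w]).
Proof.
suff H n : forall P, (size P <= n)%N -> exists Y : {poly R[i]},
    forall w, normc w = 1 -> normc P.[w] ^+ 2 =
      \sum_(i < n) normc P`_i ^+ 2 + 2 * Re (w * Y.[w]) by exact: (H _ P).
elim: n => [{}P|n IH {}P sP].
  rewrite leqn0 size_poly_eq0 => /eqP ->; exists 0 => w _.
  rewrite big_ord0 !horner0 mulr0 normc0/=; ring.
have [|Y HY] := IH (drop_poly 1 P); first by rewrite size_drop_poly leq_subLR.
have PE : P = drop_poly 1 P * 'X + (P`_0)%:P.
  apply/polyP => i; rewrite coefD coefMX coefC coef_drop_poly.
  by case: i => [|i]; rewrite ?add0r //= addr0 addn1.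
exists (Y + conjc P`_0 *: drop_poly 1 P) => w w1.
rewrite [in LHS]PE [in LHS]hornerD hornerM hornerX hornerC addrC normcD_sqr.
rewrite normcM w1 mulr1 (HY w w1) big_ord_recl/=.
under [in RHS]eq_bigr => i _.
  rewrite (_ : P`_(bump 0 i) = (drop_poly 1 P)`_i); last first.
    by rewrite coef_drop_poly addn1.
  over.
rewrite hornerD hornerZ mulrDr ReD.
rewrite [w * (_ * _)]mulrCA [w * (drop_poly 1 P).[w]]mulrC; ring.
Qed.

(** Partial sums of P + X^(2^k) Q either stop inside P, or consist of the
    whole of P followed by a partial sum of Q; on the circle the whole of P
    costs at most sqrt 2^(k+1), by the identity for |P|^2 + |Q|^2. *)
Lemma rudin_shapiro_step (s : R) (k : nat) P Q : s ^+ 2 = 2 -> 1 < s ->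
    (size P <= 2 ^ k)%N ->
    (forall w, normc w = 1 ->
      normc P.[w] ^+ 2 + normc Q.[w] ^+ 2 = 2 ^+ k.+1) ->
    (forall j w, normc w = 1 -> normc (take_poly j P).[w] <= 4 * s ^+ k) ->
    (forall j w, normc w = 1 -> normc (take_poly j Q).[w] <= 4 * s ^+ k) ->
  forall j w, normc w = 1 ->
    normc (take_poly j (P + Q * 'X^(2 ^ k))).[w] <= 4 * s ^+ k.+1.
Proof.
move=> s2 s1 sP pq bP bQ j w w1; rewrite take_polyD take_polyMXn.
have s0 : 0 <= s ^+ k by rewrite exprn_ge0//; lra.
have [jk|jk] := leqP j (2 ^ k).
  have -> : (j - 2 ^ k)%N = 0%N by apply/eqP; rewrite subn_eq0.
  rewrite take_poly0l mul0r addr0 (le_trans (bP _ _ w1))// exprS.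
  by rewrite ler_pM2l// ler_peMl// ltW.
rewrite take_poly_id ?(leq_trans sP (ltnW jk))//.
rewrite hornerD hornerM hornerXn (le_trans (ler_normcD _ _))//.
rewrite normcM normcX w1 expr1n mulr1.
have Ps : normc P.[w] <= s * s ^+ k.
  rewrite -(@ler_pXn2r _ 2)// ?nnegrE ?normc_ge0 ?mulr_ge0//; last by lra.
  rewrite exprMn -exprM mulnC exprM s2 -exprS -(pq _ w1).
  by rewrite lerDl sqr_ge0.
have := bQ (j - 2 ^ k)%N w w1; rewrite exprS; nra.
Qed.

(** The Rudin-Shapiro pairs: (P, Q) is replaced by (P + X^(2^k) Q, P - X^(2^k)
    Q), and the parallelogram identity keeps |P|^2 + |Q|^2 constant on the
    circle.  The factor 4 in the bound for partial sums is what the recursion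
    B_(k+1) = B_k + sqrt 2^(k+1) allows. *)
Lemma rudin_shapiro_aux (s : R) (k : nat) : s ^+ 2 = 2 -> 1 < s ->
  4 / 3 <= s ->
  exists P Q, [/\ (size P <= 2 ^ k)%N, (size Q <= 2 ^ k)%N,
    (forall i, (i < 2 ^ k)%N -> normc P`_i = 1 /\ normc Q`_i = 1),
    (forall w, normc w = 1 ->
      normc P.[w] ^+ 2 + normc Q.[w] ^+ 2 = 2 ^+ k.+1) &
    forall j w, normc w = 1 -> normc (take_poly j P).[w] <= 4 * s ^+ k /\
      normc (take_poly j Q).[w] <= 4 * s ^+ k].
Proof.
move=> s2 s1 s43; elim: k => [|k [P [Q [sP sQ cPQ nPQ bPQ]]]].
  exists 1, 1; rewrite !size_poly1 expn0; split => //.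
  - by move=> [|i]//; rewrite coef1 normc1.
  - by move=> w _; rewrite hornerC normc1; ring.
  - move=> j w w1.
    suff : normc (take_poly j 1).[w] <= 4 by rewrite expr0 mulr1.
    case: j => [|j]; first by rewrite take_poly0l horner0 normc0.
    by rewrite take_poly_id ?size_poly1// hornerC normc1; lra.
exists (P + Q * 'X^(2 ^ k)), (P + (- Q) * 'X^(2 ^ k)).
have size_step (U : {poly R[i]}) : (size U <= 2 ^ k)%N ->
    (size (P + U * 'X^(2 ^ k))%R <= 2 ^ k.+1)%N.
  move=> sU; apply: (leq_trans (size_polyD _ _)); rewrite geq_max expnS mul2n.
  rewrite -addnn (leq_trans sP) ?leq_addr//=.
  apply: (leq_trans (size_polyMleq _ _)).
  by rewrite size_polyXn addnS/= leq_add2r.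
have coef_step (U : {poly R[i]}) i : (i < 2 ^ k.+1)%N ->
    (forall i, (i < 2 ^ k)%N -> normc U`_i = 1) ->
    normc (P + U * 'X^(2 ^ k))`_i = 1.
  move=> ik cU; rewrite coefD coefMXn; case: ltnP => ik2.
    by rewrite addr0; exact: (cPQ _ ik2).1.
  rewrite nth_default ?add0r; last exact: leq_trans sP ik2.
  by apply: cU; rewrite ltn_subLR// addnn -mul2n -expnS.
split; rewrite ?size_step ?size_polyN//.
- move=> i ik; split; apply: coef_step => // l lk.
    exact: (cPQ _ lk).2.
  by rewrite coefN normc_neg; exact: (cPQ _ lk).2.
- move=> w w1; rewrite !hornerD !hornerM hornerN hornerXn mulNr.
  by rewrite normc_parallelogram normcM normcX w1 expr1n mulr1 nPQ//.
- move=> j w w1; split; apply: rudin_shapiro_step => //.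
  + by move=> *; apply: (bPQ _ _ _).1.
  + by move=> *; apply: (bPQ _ _ _).2.
  + by move=> *; rewrite hornerN normc_neg nPQ.
  + by move=> *; apply: (bPQ _ _ _).1.
  + move=> i v v1; rewrite -scaleN1r take_polyZ hornerZ mulN1r normc_neg.
    by apply: (bPQ _ _ _).2.
Qed.

Lemma expr_le_eps (r e : R) : 0 <= r < 1 -> 0 < e -> exists n, r ^+ n <= e.
Proof.
move=> /andP[r0 r1] e0; have : `|r| < 1 by rewrite ger0_norm.
move=> /cvg_expr /cvgrPdist_le /(_ _ e0) [n _ /(_ n (leqnn n))] h.
by exists n; apply: le_trans h; rewrite sub0r normrN ler_norm.
Qed.

(** Rudin-Shapiro polynomials of large degree, divided by their norm in L^2.
    Small coefficients make a block harmless when it is cut in the middle, and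
    bounded partial sums when it is cut between two of its terms. *)
Lemma flat_poly (kappa : R) : 0 < kappa ->
  exists Z : {poly R[i]}, [/\ forall i, normc Z`_i <= kappa,
    \sum_(i < size Z) normc Z`_i ^+ 2 = 1 &
    forall j w, normc w = 1 -> normc (take_poly j Z).[w] <= 4].
Proof.
move=> kappa0; pose s : R := Num.sqrt 2.
have s2 : s ^+ 2 = 2 by rewrite sqr_sqrtr.
have s0 : 0 <= s by exact: sqrtr_ge0.
have s43 : 4 / 3 <= s.
  rewrite leNgt; apply/negP => h; suff : s ^+ 2 < 2 by rewrite s2 ltxx.
  by nra.
have [k Hk] : exists k, s^-1 ^+ k <= kappa.
  apply: expr_le_eps => //; rewrite invr_ge0 s0/= invf_lt1; lra.
have s1 : 1 < s by lra.
have [P [Q [sP sQ cPQ nPQ bPQ]]] := rudin_shapiro_aux k s2 s1 s43.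
have sk0 : 0 < s ^+ k by rewrite exprn_gt0//; lra.
have skC : normc ((s ^+ k)^-1%:C) = (s ^+ k)^-1.
  by rewrite normc_real ger0_norm// invr_ge0 ltW.
have c0 : (s ^+ k)^-1%:C != 0.
  by rewrite -normc_gt0 skC invr_gt0.
have sPk : size P = (2 ^ k)%N.
  apply/eqP; rewrite eqn_leq sP leqNgt; apply/negP => h.
  have k0 : (0 < 2 ^ k)%N by rewrite expn_gt0.
  have k1 : ((2 ^ k).-1 < 2 ^ k)%N by rewrite prednK.
  have [/eqP + _] := cPQ _ k1; rewrite nth_default; last by rewrite -ltnS prednK.
  by rewrite normc0 eq_sym oner_eq0.
exists ((s ^+ k)^-1%:C *: P); split.
- move=> i; rewrite coefZ normcM skC; have [ik|ik] := ltnP i (2 ^ k).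
    by rewrite (cPQ _ ik).1 mulr1 -exprVn.
  rewrite nth_default ?(leq_trans sP)// normc0 mulr0.
  exact: ltW.
- rewrite size_scale// sPk (eq_bigr (fun=> (2 ^+ k)^-1)).
    by rewrite sumr_const card_ord -[LHS]mulr_natr natrX mulVf// expf_neq0.
  move=> i _; rewrite coefZ normcM skC (cPQ _ (ltn_ord i)).1 mulr1 exprVn.
  by rewrite -exprM mulnC exprM s2.
- move=> j w w1; rewrite take_polyZ hornerZ normcM skC mulrC ler_pdivrMr//.
  exact: (bPQ _ _ w1).1.
Qed.

(** * Polynomial approximations of a cutoff and of the inverse *)

Lemma bernoulli_upper (x : R) K : 0 <= x <= 1 ->
  (1 - x) ^+ K * (1 + K%:R * x) <= 1.
Proof.
move=> /andP[x0 x1]; elim: K => [|K IH]; first by rewrite expr0; lra.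
apply: le_trans IH; rewrite exprSr -mulrA ler_wpM2l ?exprn_ge0//; first lra.
rewrite -natr1; have : (0 : R) <= K%:R by []. nra.
Qed.

Lemma bernoulli_lower (x : R) K : 0 <= x <= 1 -> 1 - K%:R * x <= (1 - x) ^+ K.
Proof.
move=> /andP[x0 x1]; elim: K => [|K IH]; first by rewrite expr0; lra.
rewrite exprSr (@le_trans _ _ ((1 - K%:R * x) * (1 - x)))//.
  rewrite -natr1; have : (0 : R) <= K%:R by []. nra.
by rewrite ler_wpM2r//; lra.
Qed.

(** The polynomial 1 - (1 - v^m)^K separates [0, a] from [b, 1]: by the
    Bernoulli inequalities it is at most K v^m, and at least 1 - 1 / (1 + K
    v^m).  Taking K of order b^(-m) makes the second quantity at least 1/2
    beyond b, while K a^m is of order (a / b)^m. *)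
Lemma cutoff_exponents (a b e : R) : 0 <= a -> a < b -> b <= 1 -> 0 < e ->
  exists m K : nat, forall v, 0 <= v <= 1 ->
    [/\ 0 <= 1 - (1 - v ^+ m) ^+ K <= 1,
        v <= a -> 1 - (1 - v ^+ m) ^+ K <= e &
        b <= v -> 2^-1 <= 1 - (1 - v ^+ m) ^+ K].
Proof.
move=> a0 ab b1 e0; have b0 : 0 < b by lra.
have [m Hm] : exists m, (a / b) ^+ m <= e / 2.
  apply: expr_le_eps; last by lra.
  by rewrite divr_ge0 ?(ltW b0)//= ltr_pdivrMr// mul1r.
have bm0 : 0 < b ^+ m by rewrite exprn_gt0.
have bm1 : b ^+ m <= 1 by rewrite exprn_ile1// ltW.
have /ltW K0 := truncnS_gt (b ^+ m)^-1; have := truncn_le (b ^+ m)^-1.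
rewrite invr_ge0 (ltW bm0) => K1; set K := (Num.truncn _).+1 in K0.
have Kb1 : 1 <= K%:R * b ^+ m by rewrite -ler_pdivrMr// mul1r.
have Kb2 : K%:R * b ^+ m <= 2.
  rewrite -ler_pdivlMr// /K -natr1; apply: (@le_trans _ _ ((b ^+ m)^-1 + (b ^+ m)^-1)).
    by rewrite lerD// invf_ge1.
  lra.
exists m, K => v /andP[v0 v1].
have vm0 : 0 <= v ^+ m by rewrite exprn_ge0.
have vm1 : v ^+ m <= 1 by rewrite exprn_ile1.
have t0 : 0 <= (1 - v ^+ m) ^+ K by rewrite exprn_ge0//; lra.
have t1 : (1 - v ^+ m) ^+ K <= 1 by rewrite exprn_ile1//; lra.
split.
- lra.
- move=> va; have := @bernoulli_lower (v ^+ m) K; rewrite vm0 vm1 => /(_ isT).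
  have Kv : K%:R * v ^+ m <= e.
    have vam : v ^+ m <= a ^+ m by rewrite lerXn2r// nnegrE.
    have : a ^+ m <= e / 2 * b ^+ m by rewrite -ler_pdivrMr// -expr_div_n.
    have : (0 : R) <= K%:R by []. nra.
  lra.
- move=> bv; have := @bernoulli_upper (v ^+ m) K; rewrite vm0 vm1 => /(_ isT).
  have : 1 <= K%:R * v ^+ m.
    rewrite (le_trans Kb1)// ler_wpM2l// lerXn2r// nnegrE; lra.
  nra.
Qed.

Lemma inv_geometric (c C v : R) J : 0 < c -> c <= v -> v <= C ->
  `|v^-1 - C^-1 * \sum_(j < J) (1 - v / C) ^+ j| <= (1 - c / C) ^+ J / c.
Proof.
move=> c0 cv vC; have v0 : 0 < v by lra.
have C0 : 0 < C by lra.
have q0 : 0 <= 1 - v / C by rewrite subr_ge0 ler_pdivrMr ?mul1r.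
have -> : v^-1 - C^-1 * \sum_(j < J) (1 - v / C) ^+ j = (1 - v / C) ^+ J / v.
  have := subrXX 1 (1 - v / C) J; rewrite expr1n.
  under eq_bigr do rewrite expr1n mul1r.
  rewrite (_ : 1 - (1 - v / C) = v / C); last by ring.
  move=> h; apply: (mulfI (lt0r_neq0 v0)).
  rewrite mulrBr divff ?gt_eqF// mulrA -h.
  by rewrite mulrCA divff ?gt_eqF// mulr1; ring.
rewrite ger0_norm; last by rewrite divr_ge0 ?exprn_ge0// ltW.
apply: ler_pM; rewrite ?invr_ge0 ?exprn_ge0 ?(ltW v0)//; last by rewrite lef_pV2.
have ci : c / C <= v / C by rewrite ler_pM2r ?invr_gt0.
rewrite lerXn2r// ?nnegrE; lra.
Qed.

End Flat.

(** * Means over the circle *)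

Section Mean.
Context {R : realType}.
Implicit Types (g h : R -> R).

Definition circle_int g : R := \int[@lebesgue_measure R]_(t in `[0, 2 * pi]) g t.

Lemma cont_cst (a : R) : continuous (fun _ : R => a).
Proof. exact: cst_continuous. Qed.

Lemma contD g h : continuous g -> continuous h -> continuous (fun t => g t + h t).
Proof. by move=> cg ch t; apply: cvgD; [exact: cg|exact: ch]. Qed.

Lemma contN g : continuous g -> continuous (fun t => - g t).
Proof. by move=> cg t; apply: cvgN; exact: cg. Qed.

Lemma contB g h : continuous g -> continuous h -> continuous (fun t => g t - h t).
Proof. by move=> cg ch t; apply: cvgB; [exact: cg|exact: ch]. Qed.

Lemma contM g h : continuous g -> continuous h -> continuous (fun t => g t * h t).
Proof. by move=> cg ch t; apply: cvgM; [exact: cg|exact: ch]. Qed.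

Lemma contX g n : continuous g -> continuous (fun t => g t ^+ n).
Proof.
move=> cg; elim: n => [|n IH].
  by under [X in continuous X]funext do rewrite expr0; exact: cont_cst.
by under [X in continuous X]funext do rewrite exprS; exact: contM.
Qed.

Lemma contV g : continuous g -> (forall t, g t != 0) ->
  continuous (fun t => (g t)^-1).
Proof. by move=> cg g0 t; apply: cvgV => //; exact: cg. Qed.

Lemma cont_sum (I : Type) (r : seq I) (F : I -> R -> R) :
  (forall i, continuous (F i)) -> continuous (fun t => \sum_(i <- r) F i t).
Proof.
move=> cF; elim: r => [|i r IH].
  by under [X in continuous X]funext do rewrite big_nil; exact: cont_cst.
by under [X in continuous X]funext do rewrite big_cons; exact: contD.
Qed.

Lemma pi2_gt0 : 0 < 2 * pi :> R.
Proof. by rewrite mulr_gt0// pi_gt0. Qed.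

Definition circle_integrable g :=
  (@lebesgue_measure R).-integrable `[0, 2 * pi] (EFin \o g).

Lemma cont_integrable g : continuous g -> circle_integrable g.
Proof.
move=> cg; apply: continuous_compact_integrable; first exact: segment_compact.
exact: continuous_subspaceT.
Qed.

Lemma integrable_cst (a : R) : circle_integrable (fun=> a).
Proof. by apply: cont_integrable; exact: cont_cst. Qed.

Lemma integrable_add g h : circle_integrable g -> circle_integrable h ->
  circle_integrable (fun t => g t + h t).
Proof.
move=> ig ih; rewrite /circle_integrable.
have -> : EFin \o (fun t => g t + h t) = ((EFin \o g) \+ (EFin \o h))%E by [].
exact: integrableD.
Qed.

Lemma integrable_scale (a : R) g : circle_integrable g ->
  circle_integrable (fun t => a * g t).
Proof.
move=> ig; rewrite /circle_integrable.
have -> : EFin \o (fun t => a * g t) = (fun t => a%:E * (EFin \o g) t)%E by [].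
exact: integrableZl.
Qed.

Lemma integrable_sub g h : circle_integrable g -> circle_integrable h ->
  circle_integrable (fun t => g t - h t).
Proof.
move=> ig ih; under eq_fun do rewrite -[X in _ - X]mul1r -mulNr.
by apply: integrable_add => //; exact: integrable_scale.
Qed.

Lemma circle_intD g h : circle_integrable g -> circle_integrable h ->
  circle_int (fun t => g t + h t) = circle_int g + circle_int h.
Proof. by move=> ig ih; exact: RintegralD. Qed.

Lemma circle_intB g h : circle_integrable g -> circle_integrable h ->
  circle_int (fun t => g t - h t) = circle_int g - circle_int h.
Proof. by move=> ig ih; exact: RintegralB. Qed.

Lemma circle_intZ (a : R) g : circle_integrable g ->
  circle_int (fun t => a * g t) = a * circle_int g.
Proof. by move=> ig; exact: RintegralZl. Qed.

Lemma circle_int_cst (a : R) : circle_int (fun=> a) = a * (2 * pi).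
Proof.
rewrite /circle_int Rintegral_cst//; congr (_ * _).
by rewrite /= lebesgue_measure_itv/= lte_fin pi2_gt0/= subr0.
Qed.

Lemma le_circle_int g h : circle_integrable g -> circle_integrable h ->
  (forall t, g t <= h t) -> circle_int g <= circle_int h.
Proof. by move=> ig ih gh; exact: le_Rintegral. Qed.

Lemma circle_int_sum (I : Type) (r : seq I) (F : I -> R -> R) :
  (forall i, continuous (F i)) ->
  circle_int (fun t => \sum_(i <- r) F i t) = \sum_(i <- r) circle_int (F i).
Proof.
move=> cF; elim: r => [|i r IH].
  under [X in circle_int X]funext do rewrite big_nil.
  by rewrite circle_int_cst mul0r big_nil.
rewrite big_cons -IH -circle_intD; last 2 first.
- by apply: cont_integrable; exact: cF.
- by apply: cont_integrable; exact: cont_sum.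
by congr circle_int; apply/funext => t; rewrite big_cons.
Qed.

Lemma circle_int_close g h (K : R) : circle_integrable g -> circle_integrable h ->
  (forall t, `|g t - h t| <= K) -> `|circle_int g - circle_int h| <= K * (2 * pi).
Proof.
move=> cg ch gh; have cK : circle_integrable (fun _ : R => K).
  exact: integrable_cst.
rewrite -circle_int_cst ler_norml lerNl opprB !lerBlDl -!circle_intD//.
apply/andP; split; apply: le_circle_int => //; try exact: integrable_add;
  move=> t; have := gh t; rewrite ler_norml => /andP[]; lra.
Qed.

Lemma bounded_integrable g (M : R) : measurable_fun setT g ->
  (forall t, `|g t| <= M) -> circle_integrable g.
Proof.
move=> mg gM; apply: measurable_bounded_integrable => //.
- by rewrite /= lebesgue_measure_itv/= lte_fin pi2_gt0 -EFinB ltry.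
- exact: measurable_funS mg.
- exists M; split; first exact: num_real.
  by move=> x Mx t _; exact: (le_trans (gM t) (ltW Mx)).
Qed.

Lemma circle_int_cvg (gs : nat -> R -> R) g (M : R) :
  (forall n, measurable_fun setT (gs n)) -> (forall n t, `|gs n t| <= M) ->
  (forall t, gs n t @[n --> \oo] --> g t) ->
  circle_int (gs n) @[n --> \oo] --> circle_int g.
Proof.
move=> mgs gsM gsg.
have mg : measurable_fun setT g by apply: measurable_fun_cvg => // t _; exact: gsg.
have gM t : `|g t| <= M.
  have /cvgrPdist_lt H := gsg t; rewrite leNgt; apply/negP => Mg.
  have [|n _ /(_ n (leqnn n)) Hn] := H (`|g t| - M); first by rewrite subr_gt0.
  have := ler_normD (g t - gs n t) (gs n t); rewrite subrK => h.
  have := gsM n t; lra.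
have ig := bounded_integrable mg gM.
have mD := measurable_itv `[0, 2 * pi : R].
have H := @dominated_convergence _ _ _ (@lebesgue_measure R)
   `[0, 2 * pi] mD (fun n => EFin \o gs n) (EFin \o g) (cst M%:E).
have [| | | | |_ _ {}H] := H.
- by move=> n; apply/measurable_EFinP; exact: measurable_funS (mgs n).
- by apply/measurable_EFinP; exact: measurable_funS mg.
- by apply: aeW => t _; apply: cvg_EFin; [exact: nearW|exact: gsg].
- exact: integrable_cst.
- by apply: aeW => t n _; rewrite /= lee_fin.
have fin : (\int[@lebesgue_measure R]_(x in `[0%R, (2 * pi)%R]) (EFin \o g) x)%E
    \is a fin_num by exact: integrable_fin_num.
by move: H; rewrite -(fineK fin) => /fine_cvg.
Qed.

Lemma circle_int_derive (F f : R -> R) : continuous f ->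
  (forall t : R, is_derive t 1 F (f t)) -> F (2 * pi) = F 0 -> circle_int f = 0.
Proof.
move=> cf dF F0.
have cF : continuous F.
  by move=> t; apply: differentiable_continuous; apply/derivable1_diffP;
    have [] := dF t.
rewrite /circle_int /Rintegral (@continuous_FTC2 _ f F)//.
- by rewrite F0 subee.
- exact: pi2_gt0.
- exact: continuous_subspaceT.
- split.
  + by move=> t _; have [] := dF t.
  + exact/cvg_at_right_filter/cF.
  + exact/cvg_at_left_filter/cF.
- by move=> t _; rewrite derive1E; have [] := dF t.
Qed.

Lemma expi_2piMn n : expi ((2 * pi) *+ n) = 1 :> R[i].
Proof.
by rewrite -expiX -[2 * pi]add0r expi_periodic expi0 expr1n.
Qed.

Lemma is_derive_Mn n (t : R) : is_derive t 1 (fun t : R => t *+ n) n%:R.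
Proof.
have -> : (fun t : R => t *+ n) = (fun t => n%:R * t).
  by apply/funext => x; rewrite mulr_natl.
have H := @is_deriveZ _ _ _ (@id R) n%:R t 1 1 (is_derive_id t 1).
by apply: (is_derive_eq H); rewrite /GRing.scale/= mulr1.
Qed.

Lemma continuous_Mn n : continuous (fun t : R => t *+ n).
Proof.
move=> t; apply: differentiable_continuous; apply/derivable1_diffP.
by have [] := is_derive_Mn n t.
Qed.

Lemma circle_int_cos n : circle_int (fun t => cos (t *+ n.+1)) = 0.
Proof.
apply: (@circle_int_derive (fun t => n.+1%:R^-1 * sin (t *+ n.+1))).
- move=> t; apply: continuous_comp; last exact: continuous_cos.
  exact: continuous_Mn.
- move=> t; have D := is_derive_Mn n.+1 t.
  have H := @is_derive1_comp R (@sin R) (fun t => t *+ n.+1) t _ _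
    (is_derive_sin _) D.
  apply: is_derive_eq.
  by rewrite /GRing.scale/= mulrCA mulVf// mulr1.
- by have /(congr1 (@Im R))/= -> := expi_2piMn n.+1; rewrite mul0rn sin0.
Qed.

Lemma circle_int_sin n : circle_int (fun t => sin (t *+ n.+1)) = 0.
Proof.
apply: (@circle_int_derive (fun t => - n.+1%:R^-1 * cos (t *+ n.+1))).
- move=> t; apply: continuous_comp; last exact: continuous_sin.
  exact: continuous_Mn.
- move=> t; have D := is_derive_Mn n.+1 t.
  have H := @is_derive1_comp R (@cos R) (fun t => t *+ n.+1) t _ _
    (is_derive_cos _) D.
  apply: is_derive_eq.
  by rewrite /GRing.scale/= mulNr mulNr mulrN opprK mulrCA mulVf// mulr1.
- by have /(congr1 (@Re R))/= -> := expi_2piMn n.+1; rewrite mul0rn cos0.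
Qed.

End Mean.

Ltac cont := repeat match goal with
  | H : forall _, continuous_at _ ?f |- forall _, continuous_at _ ?f => exact H
  | |- forall _, continuous_at _ (fun t => @GRing.mul _ (@?a t) (@?b t)) => refine (@contM _ a b _ _)
  | |- forall _, continuous_at _ (fun t => @Algebra.add _ (@?a t) (Algebra.opp (@?b t))) => refine (@contB _ a b _ _)
  | |- forall _, continuous_at _ (fun t => @Algebra.add _ (@?a t) (@?b t)) => refine (@contD _ a b _ _)
  | |- forall _, continuous_at _ (fun t => @Algebra.opp _ (@?a t)) => refine (@contN _ a _)
  | |- forall _, continuous_at _ (fun t => @GRing.exp _ (@?a t) ?n) => refine (@contX _ a n _)
  | |- forall _, continuous_at _ (fun _ => ?c) => refine (@cont_cst _ c)
  end.

(** * Trigonometric polynomials *)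

Section TrigPoly.
Context {R : realType}.
Implicit Types (p q : R -> R[i]) (P Q : {poly R[i]}).

Definition ccont p := continuous (fun t => Re (p t)) /\ continuous (fun t => Im (p t)).

Lemma ccont_cst (a : R[i]) : ccont (fun=> a).
Proof. by split; exact: cst_continuous. Qed.

Lemma ccontD p q : ccont p -> ccont q -> ccont (fun t => p t + q t).
Proof.
move=> [p1 p2] [q1 q2]; split.
  under [X in continuous X]funext do rewrite ReD.
  exact: contD.
under [X in continuous X]funext do rewrite ImD.
exact: contD.
Qed.

Lemma ccontM p q : ccont p -> ccont q -> ccont (fun t => p t * q t).
Proof.
move=> [p1 p2] [q1 q2]; split.
  under [X in continuous X]funext do rewrite ReM.
  by apply: contB; apply: contM.
under [X in continuous X]funext do rewrite ImM.
by apply: contD; apply: contM.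
Qed.

Lemma ccontX p n : ccont p -> ccont (fun t => p t ^+ n).
Proof.
move=> cp; elim: n => [|n IH].
  under [X in ccont X]funext do rewrite expr0.
  exact: ccont_cst.
by under [X in ccont X]funext do rewrite exprS; exact: ccontM.
Qed.

Lemma ccont_conj p : ccont p -> ccont (fun t => conjc (p t)).
Proof.
move=> [p1 p2]; split.
  by under [X in continuous X]funext do rewrite Re_conjc.
under [X in continuous X]funext do rewrite Im_conjc.
exact: contN.
Qed.

Lemma ccont_real (g : R -> R) : continuous g -> ccont (fun t => (g t)%:C).
Proof. by move=> cg; split => //=; exact: cst_continuous. Qed.

Lemma continuous_normc_sqr p : ccont p -> continuous (fun t => normc (p t) ^+ 2).
Proof.
move=> [p1 p2].
under [X in continuous X]funext do rewrite normc_sqr.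
by apply: contD; apply: contX.
Qed.

Lemma ccontV p : ccont p -> (forall t, p t != 0) -> ccont (fun t => (p t)^-1).
Proof.
move=> cp p0.
under [X in ccont X]funext do rewrite invc_conj//.
apply: ccontM; first exact: ccont_conj.
apply: ccont_real; apply: contV; first exact: continuous_normc_sqr.
by move=> t; rewrite expf_neq0// normc_eq0.
Qed.

Lemma ccont_expi : ccont (@expi R).
Proof. by split => /=; [exact: continuous_cos|exact: continuous_sin]. Qed.

Lemma ccont_horner P p : ccont p -> ccont (fun t => P.[p t]).
Proof.
move=> cp; elim/poly_ind: P => [|P c IH].
  under [X in ccont X]funext do rewrite horner0.
  exact: ccont_cst.
under [X in ccont X]funext do rewrite hornerD hornerM hornerX hornerC.
apply: ccontD; last exact: ccont_cst.
exact: ccontM.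
Qed.

(** Trigonometric polynomials, encoded through a polynomial in e^(it) after
    multiplication by a power of e^(it), so that no negative exponents are
    needed. *)
Definition trigpoly p :=
  exists (d : nat) (Q : {poly R[i]}), forall t, expi t ^+ d * p t = Q.[expi t].

Lemma trigpoly_horner P : trigpoly (fun t => P.[expi t]).
Proof. by exists 0%N, P => t; rewrite expr0 mul1r. Qed.

Lemma trigpoly_cst (a : R[i]) : trigpoly (fun=> a).
Proof. by exists 0%N, a%:P => t; rewrite expr0 mul1r hornerC. Qed.

Lemma trigpolyD p q : trigpoly p -> trigpoly q -> trigpoly (fun t => p t + q t).
Proof.
move=> [d [P HP]] [e [Q HQ]]; exists (d + e)%N, ('X^e * P + 'X^d * Q) => t.
rewrite hornerD !hornerM !hornerXn -HP -HQ exprD; ring.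
Qed.

Lemma trigpolyM p q : trigpoly p -> trigpoly q -> trigpoly (fun t => p t * q t).
Proof.
move=> [d [P HP]] [e [Q HQ]]; exists (d + e)%N, (P * Q) => t.
rewrite hornerM -HP -HQ exprD; ring.
Qed.

Lemma trigpolyX p n : trigpoly p -> trigpoly (fun t => p t ^+ n).
Proof.
move=> cp; elim: n => [|n IH].
  under [X in trigpoly X]funext do rewrite expr0.
  exact: trigpoly_cst.
by under [X in trigpoly X]funext do rewrite exprS; exact: trigpolyM.
Qed.

Lemma trigpoly_sum (I : Type) (r : seq I) (F : I -> R -> R[i]) :
  (forall i, trigpoly (F i)) -> trigpoly (fun t => \sum_(i <- r) F i t).
Proof.
move=> cF; elim: r => [|i r IH].
  under [X in trigpoly X]funext do rewrite big_nil.
  exact: trigpoly_cst.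
by under [X in trigpoly X]funext do rewrite big_cons; exact: trigpolyD.
Qed.

Lemma trigpoly_conj_expi : trigpoly (fun t => conjc (expi t)).
Proof. by exists 1%N, 1 => t; rewrite expr1 mulrC expi_conjM hornerC. Qed.

Lemma trigpoly_conj_horner P : trigpoly (fun t => conjc P.[expi t]).
Proof.
elim/poly_ind: P => [|P c IH].
  under [X in trigpoly X]funext do rewrite horner0.
  exact: trigpoly_cst.
under [X in trigpoly X]funext do
  rewrite hornerD hornerM hornerX hornerC rmorphD rmorphM/=.
apply: trigpolyD; last exact: trigpoly_cst.
by apply: trigpolyM => //; exact: trigpoly_conj_expi.
Qed.

Lemma trigpoly_normc_sqr P : trigpoly (fun t => (normc P.[expi t] ^+ 2)%:C).
Proof.
under [X in trigpoly X]funext do rewrite -conjc_mul_self.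
by apply: trigpolyM; [exact: trigpoly_conj_horner|exact: trigpoly_horner].
Qed.

Lemma trigpolyE p d Q : (forall t, expi t ^+ d * p t = Q.[expi t]) ->
  p = (fun t => conjc (expi t) ^+ d * Q.[expi t]).
Proof.
by move=> H; apply/funext => t; rewrite -H mulrA -exprMn expi_conjM expr1n mul1r.
Qed.

Lemma trigpoly_cont p : trigpoly p -> ccont p.
Proof.
move=> [d [Q /trigpolyE ->]]; apply: ccontM.
  by apply: ccontX; apply: ccont_conj; exact: ccont_expi.
by apply: ccont_horner; exact: ccont_expi.
Qed.

Lemma circle_int_analytic P : circle_int (fun t => Re (expi t * P.[expi t])) = 0.
Proof.
under [X in circle_int X]funext => t.
  rewrite horner_coef mulr_sumr.
  rewrite (_ : Re _ = \sum_(i < size P) (Re P`_i * cos (t *+ i.+1)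
      + - Im P`_i * sin (t *+ i.+1))); last first.
    rewrite (big_morph _ (@ReD R) (erefl : Re (0 : R[i]) = 0)).
    apply: eq_bigr => i _; rewrite mulrCA -exprS expiX ReM/= mulNr.
    by [].
  over.
have cc n : continuous (fun t : R => cos (t *+ n)).
  move=> t; apply: continuous_comp; last exact: continuous_cos.
  exact: continuous_Mn.
have cs n : continuous (fun t : R => sin (t *+ n)).
  move=> t; apply: continuous_comp; last exact: continuous_sin.
  exact: continuous_Mn.
have cZ (a : R) g : continuous g -> continuous (fun t : R => a * g t).
  by move=> cg; apply: contM => //; exact: cont_cst.
rewrite circle_int_sum; last first.
  by move=> i; apply: contD; apply: cZ.
rewrite big1// => i _; rewrite circle_intD ?circle_intZ//;
  try by apply: cont_integrable => //; exact: cZ.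
by rewrite circle_int_cos circle_int_sin !mulr0 addr0.
Qed.

(** Once N exceeds the degree of p, every frequency of p(t) e^(iNt) P(e^(iNt))
    is positive.  This exact orthogonality replaces the independence of the
    increments. *)
Lemma circle_int_high_freq p : trigpoly p -> exists D : nat, forall N P,
  (D < N)%N ->
  circle_int (fun t => Re (p t * (expi t ^+ N * P.[expi t ^+ N]))) = 0.
Proof.
move=> [d [Q /trigpolyE ->]]; exists d => N P dN.
rewrite -[RHS](circle_int_analytic ('X^(N - d.+1) * Q * (P \Po 'X^N))).
congr circle_int; apply/funext => t; congr Re.
rewrite !hornerM horner_comp !hornerXn.
have -> : expi t ^+ N = expi t ^+ d * (expi t * expi t ^+ (N - d.+1)).
  by rewrite -exprS -exprD; congr (_ ^+ _); lia.
have := expi_conjM t => h.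
transitivity ((conjc (expi t) * expi t) ^+ d * (expi t * (expi t ^+ (N - d.+1) *
  Q.[expi t] * P.[expi t ^+ d * (expi t * expi t ^+ (N - d.+1))]))).
  by rewrite exprMn; ring.
by rewrite h expr1n mul1r.
Qed.

End TrigPoly.

(** * Adding blocks of high frequency *)

Section Surgery.
Context {R : realType}.
Implicit Types (P Q Z F : {poly R[i]}) (z : R[i]).

Definition coef_norm P : R := \sum_(i < size P) normc P`_i.

Lemma coef_norm_ge0 P : 0 <= coef_norm P.
Proof. by apply: sumr_ge0 => i _; exact: normc_ge0. Qed.

Lemma normc_take_poly_le P m z : normc z = 1 ->
  normc (take_poly m P).[z] <= coef_norm P.
Proof.
move=> z1; rewrite horner_coef (le_trans (normc_sum _ _ _))//.
have sP : (size (take_poly m P) <= size P)%N.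
  by apply/leq_sizeP => j Pj; rewrite coef_take_poly nth_default ?if_same.
rewrite /coef_norm (big_ord_widen _ (fun i => normc ((take_poly m P)`_i * z ^+ i)) sP).
rewrite big_mkcond/=; apply: ler_sum => i _; case: ifP => _; last exact: normc_ge0.
rewrite normcM normcX z1 expr1n mulr1 coef_take_poly; case: ifP => // _.
by rewrite normc0 normc_ge0.
Qed.

Lemma normc_horner_le P z : normc z = 1 -> normc P.[z] <= coef_norm P.
Proof. by move=> z1; rewrite -{1}[P](@take_poly_id _ (size P))// normc_take_poly_le. Qed.

(** The increment to be added to F_n: the term of index l is the trigonometric
    polynomial e^(-idt) Q(e^(it)) moved to the frequency (l + 1) N, with the
    coefficient of Z. *)
Definition blocks Z Q (d N n : nat) : {poly R[i]} :=
  \sum_(l < n) Z`_l *: (Q * 'X^(l.+1 * N - d)).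

Lemma horner_take_poly Z j z : (take_poly j Z).[z] = \sum_(l < j) Z`_l * z ^+ l.
Proof. by rewrite /take_poly horner_poly. Qed.

Lemma horner_blocks Z Q (d N n : nat) z q : (d <= N)%N -> normc z = 1 ->
  z ^+ d * q = Q.[z] ->
  (blocks Z Q d N n).[z] = q * (z ^+ N * (take_poly n Z).[z ^+ N]).
Proof.
move=> dN z1 qE; rewrite horner_take_poly horner_sum mulr_sumr mulr_sumr.
apply: eq_bigr => l _; rewrite hornerZ hornerM hornerXn -qE.
have -> : z ^+ N * (Z`_l * (z ^+ N) ^+ l) = Z`_l * z ^+ (l.+1 * N).
  by rewrite mulrCA -exprM -exprD mulSn [(l * N)%N]mulnC.
have : (d <= l.+1 * N)%N by rewrite mulSn (leq_trans dN) ?leq_addr.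
by move=> h; rewrite -[in RHS](subnKC h) exprD; ring.
Qed.

Lemma size_blocks Z Q (d N n : nat) : (d + size Q <= N)%N ->
  (size (blocks Z Q d N n) <= n.+1 * N - d)%N.
Proof.
move=> dN; apply: (leq_trans (size_sum _ _ _)); apply/bigmax_leqP => l _.
apply: (leq_trans (size_scale_leq _ _)).
apply: (leq_trans (size_polyMleq _ _)); rewrite size_polyXn addnS/=.
have : (l.+2 * N <= n.+1 * N)%N by rewrite leq_mul2r ltnS ltn_ord orbT.
rewrite mulSn; have : (N <= l.+1 * N)%N by rewrite mulSn leq_addr.
by move: (l.+1 * N)%N (n.+1 * N)%N (size Q) dN => a b c; lia.
Qed.

(** A partial sum of the increment consists of complete terms, which amount to
    a partial sum of Z, and of at most one term cut in the middle, for which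
    the bound on the coefficients of Z is used. *)
Lemma take_blocks Z Q (d N n m : nat) (kappa : R) z q : (d + size Q <= N)%N ->
  0 <= kappa -> (forall l, normc Z`_l <= kappa) ->
  normc z = 1 -> z ^+ d * q = Q.[z] ->
  exists j, normc ((take_poly m (blocks Z Q d N n)).[z]
    - q * (z ^+ N * (take_poly j Z).[z ^+ N])) <= kappa * coef_norm Q.
Proof.
move=> dN kappa0 Zk z1 qE; have dN' : (d <= N)%N by lia.
have A0 := coef_norm_ge0 Q.
elim: n => [|n [j IH]].
  exists 0%N; rewrite /blocks big_ord0 take_poly0r take_poly0l !horner0.
  by rewrite !mulr0 subr0 normc0 mulr_ge0.
have E : blocks Z Q d N n.+1 = blocks Z Q d N n + Z`_n *: (Q * 'X^(n.+1 * N - d)).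
  by rewrite /blocks big_ord_recr.
rewrite E take_polyD take_polyZ take_polyMXn.
have [mN|mN] := leqP m (n.+1 * N - d).
  exists j; have -> : (m - (n.+1 * N - d))%N = 0%N by apply/eqP; rewrite subn_eq0.
  by rewrite take_poly0l mul0r scaler0 addr0.
exists n; rewrite take_poly_id; last first.
  by rewrite (leq_trans (size_blocks Z n dN))// ltnW.
rewrite hornerD (horner_blocks _ _ dN' z1 qE) addrAC subrr add0r.
rewrite hornerZ hornerM hornerXn normcM normcM normcX z1 expr1n mulr1.
by rewrite ler_pM ?normc_ge0// normc_take_poly_le.
Qed.

Lemma take_blocks0 Z Q (d N n s : nat) : (d + s <= N)%N ->
  take_poly s (blocks Z Q d N n) = 0.
Proof.
move=> dN; rewrite take_poly_sum big1// => l _; rewrite take_polyZ take_polyMXn.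
have -> : (s - (l.+1 * N - d))%N = 0%N.
  apply/eqP; rewrite subn_eq0 mulSn; lia.
by rewrite take_poly0l mul0r scaler0.
Qed.

End Surgery.

(** * Effect of one increment on the means *)

Section Increment.
Context {R : realType}.
Variables (F F' : {poly R[i]}) (w : R -> R) (G : R -> R[i]) (rho : R).
Hypothesis F_ge : forall t, 2 / 5 <= normc F.[expi t].
Hypothesis rho_ge0 : 0 <= rho.
Hypothesis rho_le : rho <= 16^-1.
Hypothesis w_ge0 : forall t, 0 <= w t.
Hypothesis w_le : forall t, w t <= rho.
Hypothesis w_cont : continuous w.
Hypothesis G_cont : ccont G.
Hypothesis G_le : forall t, normc (G t) <= 4.
Let u t : R[i] := (w t)%:C * G t.
Hypothesis F'E : forall t, F'.[expi t] = F.[expi t] * (1 + u t).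

Let v t := normc F.[expi t] ^+ 2.
Let v' t := normc F'.[expi t] ^+ 2.

Let u_cont : ccont u.
Proof. by apply: ccontM => //; exact: ccont_real. Qed.

Lemma normc_incr_le t : normc (u t) <= 4 * rho.
Proof.
rewrite /u normcM normc_real ger0_norm// mulrC.
by rewrite ler_pM ?normc_ge0.
Qed.

Let u_le4 t : normc (u t) <= 4^-1.
Proof. by rewrite (le_trans (normc_incr_le t))//; move: rho_le; lra. Qed.

Let u3_le t : normc (u t) ^+ 3 <= 64 * rho ^+ 3.
Proof.
have : normc (u t) ^+ 3 <= (4 * rho) ^+ 3.
  by rewrite lerXn2r ?nnegrE ?normc_ge0 ?mulr_ge0// normc_incr_le.
by rewrite exprMn; lra.
Qed.

Let u2_le t : normc (u t) ^+ 2 <= 16^-1.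
Proof. have := u_le4 t; have := normc_ge0 (u t); nra. Qed.

Let v_ge t : 4 / 25 <= v t.
Proof. have := F_ge t; rewrite /v; nra. Qed.

Let v_inv_le t : (v t)^-1 <= 7.
Proof.
by rewrite -[leRHS]invrK lef_pV2 ?posrE//; have := v_ge t; lra.
Qed.

Let one_u_ge t : 3 / 4 <= normc (1 + u t).
Proof.
have := ler_normcB 1 (- u t); rewrite opprK normc1 normc_neg.
have := u_le4 t; lra.
Qed.

Let v'E t : v' t = v t * normc (1 + u t) ^+ 2.
Proof. by rewrite /v' F'E normcM exprMn. Qed.

Let horner_expi_cont (P : {poly R[i]}) : ccont (fun t => P.[expi t]).
Proof. by apply: ccont_horner; exact: ccont_expi. Qed.

Let v_cont : continuous v.
Proof. exact: continuous_normc_sqr. Qed.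

Let v'_cont : continuous v'.
Proof. exact: continuous_normc_sqr. Qed.

Let v'_gt0 t : 0 < v' t.
Proof.
rewrite v'E; apply: mulr_gt0; first by have := v_ge t; lra.
by rewrite exprn_gt0//; have := one_u_ge t; lra.
Qed.

Lemma cont_ln (g : R -> R) : continuous g -> (forall t, 0 < g t) ->
  continuous (fun t => ln (g t)).
Proof.
by move=> cg g0 t; apply: continuous_comp; [exact: cg|exact: continuous_ln].
Qed.

(** The mean of ln |F|^2 does not increase, up to third order, when the terms
    of first and second order of the increment average out. *)
Lemma incr_ln : circle_int (fun t => Re (u t)) = 0 ->
  circle_int (fun t => Re (u t ^+ 2)) = 0 ->
  circle_int (fun t => ln (v' t))
    <= circle_int (fun t => ln (v t)) + 768 * rho ^+ 3 * (2 * pi).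
Proof.
move=> u1 u2; have [cRu _] := u_cont; have [cRu2 _] := ccontX 2 u_cont.
have clnv : continuous (fun t => ln (v t)).
  by apply: cont_ln => // t; have := v_ge t; lra.
have clnv' : continuous (fun t => ln (v' t)) by exact: cont_ln.
have [K KE] : exists K, K = 768 * rho ^+ 3 by eexists.
pose h t := ln (v t) + (2 * Re (u t) - Re (u t ^+ 2) + K).
have ch : continuous h by rewrite /h; cont.
have -> : circle_int (fun t => ln (v t)) + 768 * rho ^+ 3 * (2 * pi) =
    circle_int h.
  rewrite /h circle_intD; [|apply: cont_integrable; cont..].
  rewrite circle_intD; [|apply: cont_integrable; cont..].
  rewrite circle_intB; [|apply: cont_integrable; cont..].
  rewrite circle_intZ; last by apply: cont_integrable; cont.
  by rewrite u1 u2 circle_int_cst KE; ring.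
apply: le_circle_int; try exact: cont_integrable.
move=> t; rewrite /h KE v'E lnM ?posrE; last 2 first.
- by have := v_ge t; lra.
- by rewrite exprn_gt0//; have := one_u_ge t; lra.
rewrite lerD2l (le_trans (ln_normc1D (u_le4 t)))// lerD2l.
have := u3_le t; lra.
Qed.

(** The mean of |F|^(-2) increases by that of w^2 |F|^(-2).  The function p
    stands for a trigonometric polynomial close to |F|^(-2), since only for
    such weights the oscillating terms have mean exactly 0. *)
Lemma incr_inv (p : R -> R) (e : R) : continuous p ->
  (forall t, `|(v t)^-1 - p t| <= e) ->
  circle_int (fun t => p t * Re (u t)) = 0 ->
  circle_int (fun t => p t * Re (u t ^+ 2)) = 0 ->
  circle_int (fun t => p t * normc (u t) ^+ 2)
    = circle_int (fun t => p t * w t ^+ 2) ->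
  circle_int (fun t => (v t)^-1) + circle_int (fun t => (v t)^-1 * w t ^+ 2)
    - (2 * e + 7168 * rho ^+ 3) * (2 * pi)
    <= circle_int (fun t => (v' t)^-1).
Proof.
move=> cp pe p1 p2 p3; have [cRu _] := u_cont; have [cRu2 _] := ccontX 2 u_cont.
have cnu := continuous_normc_sqr u_cont.
have cvi : continuous (fun t => (v t)^-1).
  by apply: contV => // t; have := v_ge t; lra.
have cvi' : continuous (fun t => (v' t)^-1).
  by apply: contV => // t; have := v'_gt0 t; lra.
have [K KE] : exists K, K = e + 7168 * rho ^+ 3 by eexists.
pose h t := (v t)^-1 + (- 2 * (p t * Re (u t)) + p t * normc (u t) ^+ 2
  + 2 * (p t * Re (u t ^+ 2))) - K.
have hv' t : h t <= (v' t)^-1.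
  rewrite v'E invfM /h KE; have := inv_normc1D (u_le4 t).
  set L := - 2 * Re (u t) + normc (u t) ^+ 2 + 2 * Re (u t ^+ 2).
  have L1 : `|L| <= 1.
    have := u_le4 t; have := u2_le t; have := Re_le (u t).
    have := Re_le (u t ^+ 2); have -> := normcX (u t) 2.
    have := sqr_ge0 (normc (u t)).
    rewrite /L !ler_norml => ? /andP[? ?] /andP[? ?] ? ?; apply/andP; split; lra.
  have pv := pe t; have u3 := u3_le t; have v7 := v_inv_le t.
  have v0 : 0 <= (v t)^-1 by rewrite invr_ge0; have := v_ge t; lra.
  have r3 : 0 <= rho ^+ 3 by rewrite exprn_ge0.
  have -> : - 2 * (p t * Re (u t)) + p t * normc (u t) ^+ 2
    + 2 * (p t * Re (u t ^+ 2)) = p t * L by rewrite /L; ring.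
  have pL : p t * L <= (v t)^-1 * L + e.
    have : `|(p t - (v t)^-1) * L| <= e.
      by rewrite normrM distrC (le_trans (ler_piMr _ L1)).
    rewrite mulrBl ler_norml => /andP[_]; lra.
  move=> /(ler_wpM2l v0); set X := (_^-1 in X in _ <= X).
  set y3 := normc (u t) ^+ 3 in u3 *.
  rewrite (_ : _ - _ = 1 + L - 16 * y3); last by rewrite /L; ring.
  rewrite mulrBr mulrDr mulr1 => le1; apply: le_trans le1.
  have : (v t)^-1 * (16 * y3) <= 7 * (16 * (64 * rho ^+ 3)).
    have y30 : 0 <= y3 by apply: exprn_ge0; exact: normc_ge0.
    by apply: ler_pM => //; [exact: mulr_ge0|rewrite ler_pM2l].
  lra.
have ch : continuous h by rewrite /h; cont.
have hE : circle_int h = circle_int (fun t => (v t)^-1)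
    + circle_int (fun t => p t * w t ^+ 2) - (e + 7168 * rho ^+ 3) * (2 * pi).
  rewrite /h circle_intB; [|apply: cont_integrable; cont..].
  rewrite circle_intD; [|apply: cont_integrable; cont..].
  rewrite circle_intD; [|apply: cont_integrable; cont..].
  rewrite circle_intD; [|apply: cont_integrable; cont..].
  rewrite circle_intZ; last by apply: cont_integrable; cont.
  rewrite circle_intZ; last by apply: cont_integrable; cont.
  by rewrite p1 p2 p3 circle_int_cst KE; ring.
have le_h : circle_int h <= circle_int (fun t => (v' t)^-1).
  by apply: le_circle_int => //; exact: cont_integrable.
apply: le_trans le_h; rewrite hE.
have : `|circle_int (fun t => (v t)^-1 * w t ^+ 2)
    - circle_int (fun t => p t * w t ^+ 2)| <= e * (2 * pi).
  apply: circle_int_close; [apply: cont_integrable; cont..|].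
  move=> t; rewrite -mulrBl normrM -[leRHS]mulr1 ler_pM//.
  rewrite ger0_norm ?sqr_ge0//; have := w_ge0 t; have := w_le t; have := rho_le; nra.
rewrite ler_norml => /andP[_]; lra.
Qed.

(** 1/F gets multiplied by 1 / (1 + u) = 1 - u + u^2 + O(u^3), where u and u^2
    average out against e^(-it) / F, here replaced by the trigonometric
    polynomial g. *)
Lemma incr_coef (p : R -> R) (e B : R) : continuous p ->
  (forall t, `|(v t)^-1 - p t| <= e) ->
  (forall t, normc F.[expi t] <= B) ->
  let g t := conjc (expi t) * conjc F.[expi t] * (p t)%:C in
  circle_int (fun t => Re (g t * u t)) = 0 ->
  circle_int (fun t => Re (g t * u t ^+ 2)) = 0 ->
  `|circle_int (fun t => Re (conjc (expi t) / F'.[expi t]))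
    - circle_int (fun t => Re (conjc (expi t) / F.[expi t]))|
    <= (320 * rho ^+ 3 + B * e) * (2 * pi).
Proof.
move=> cp pe FB g g1 g2.
have Fn0 t : F.[expi t] != 0 by rewrite -normc_gt0; have := F_ge t; lra.
have F'n0 t : F'.[expi t] != 0.
  by rewrite -normc_gt0 -(@pmulr_lgt0 _ (normc F'.[expi t])) ?v'_gt0//;
   rewrite lt0r normc_ge0 andbT; apply/eqP => h; have := v'_gt0 t;
   rewrite /v' h expr0n/= ltxx.
have ce : ccont (fun t : R => conjc (expi t)) by apply: ccont_conj; exact: ccont_expi.
have cg : ccont g.
  apply: ccontM; last exact: ccont_real.
  by apply: ccontM => //; apply: ccont_conj.
have [cF _] : ccont (fun t => conjc (expi t) / F.[expi t]).
  by apply: ccontM => //; apply: ccontV.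
have [cF' _] : ccont (fun t => conjc (expi t) / F'.[expi t]).
  by apply: ccontM => //; apply: ccontV.
have [cg1 _] := ccontM cg u_cont.
have [cg2 _] := ccontM cg (ccontX 2 u_cont).
pose h t := Re (conjc (expi t) / F.[expi t]) + (- Re (g t * u t) + Re (g t * u t ^+ 2)).
have ch : continuous h by rewrite /h; cont.
have <- : circle_int h = circle_int (fun t => Re (conjc (expi t) / F.[expi t])).
  rewrite /h circle_intD; [|apply: cont_integrable; cont..].
  rewrite circle_intD; [|apply: cont_integrable; cont..].
  under [X in _ + (circle_int X + _)]funext do rewrite -mulN1r.
  rewrite circle_intZ; last by apply: cont_integrable; cont.
  by rewrite g1 g2; ring.
apply: circle_int_close; try exact: cont_integrable.
move=> t; rewrite F'E invfM mulrA /h.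
set k := conjc (expi t) / F.[expi t].
have kn : normc k <= 5 / 2.
  rewrite normcM normc_conj normc_expi mul1r normcV.
  rewrite -[leRHS]invrK lef_pV2 ?posrE//; last by have := F_ge t; lra.
  by have := F_ge t; lra.
have kg : normc (k - g t) <= B * e.
  have -> : k - g t = conjc (expi t) * conjc F.[expi t] * ((v t)^-1 - p t)%:C.
    by rewrite rmorphB/= mulrBr /k invc_conj// mulrA.
  rewrite normcM normcM !normc_conj normc_expi mul1r normc_real.
  by rewrite ler_pM// normc_ge0.
have y3 := u3_le t.
have := Re_div1D k (u_le4 t).
have <- : Re k + (- Re (k * u t) + Re (k * u t ^+ 2)) = Re (k * (1 - u t + u t ^+ 2)).
  by rewrite -ReN -!ReD; congr Re; ring.
move=> h1.
have h2 : `|Re ((k - g t) * (- u t + u t ^+ 2))| <= B * e.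
  rewrite (le_trans (Re_le _))// normcM.
  have un : normc (- u t + u t ^+ 2) <= 1.
    have := ler_normcD (- u t) (u t ^+ 2); rewrite normc_neg.
    have -> := normcX (u t) 2.
    have := u_le4 t; have := u2_le t; lra.
  rewrite (le_trans (ler_piMr _ un))// normc_ge0//.
have E : Re k + (- Re (k * u t) + Re (k * u t ^+ 2)) =
   Re k + (- Re (g t * u t) + Re (g t * u t ^+ 2))
   + Re ((k - g t) * (- u t + u t ^+ 2)).
  by rewrite -!ReN -!ReD; congr Re; ring.
have h3 : 2 * normc k * normc (u t) ^+ 3 <= 320 * rho ^+ 3.
  have -> : 320 * rho ^+ 3 = (2 * (5 / 2)) * (64 * rho ^+ 3) by field.
  rewrite ler_pM ?mulr_ge0 ?exprn_ge0 ?normc_ge0//.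
  by rewrite ler_pM2l.
rewrite E in h1; move: h1 h2; rewrite !ler_norml => /andP[? ?] /andP[? ?].
apply/andP; split; lra.
Qed.

End Increment.

(** * One stage of the construction *)

Section Step.
Context {R : realType}.
Implicit Types (F P Q Z : {poly R[i]}).

Definition above (a : R) F (t : R) : R := ((a < normc F.[expi t])%R)%:R.

Lemma above_bound a F t : `|above a F t| <= 1.
Proof. by rewrite /above; case: ltP; rewrite ?normr1 ?normr0. Qed.

Lemma continuous_normc_expi F : continuous (fun t => normc F.[expi t]).
Proof.
have -> : (fun t => normc F.[expi t]) =
    Num.sqrt \o (fun t => normc F.[expi t] ^+ 2).
  by apply/funext => t /=; rewrite sqrtr_sqr ger0_norm ?normc_ge0.
move=> t; apply: continuous_comp; last exact: sqrt_continuous.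
by apply: continuous_normc_sqr; apply: ccont_horner; exact: ccont_expi.
Qed.

Lemma measurable_above a F : measurable_fun setT (above a F).
Proof.
have -> : above a F = (fun t => if a < normc F.[expi t] then 1 else 0).
  by apply/funext => t; rewrite /above; case: ltP.
apply: measurable_fun_ifT => //.
apply: measurable_fun_ltr => //.
apply: continuous_measurable_fun; exact: continuous_normc_expi.
Qed.

Lemma integrable_above a F : circle_integrable (above a F).
Proof. by apply: bounded_integrable; [exact: measurable_above|exact: above_bound]. Qed.

Lemma integrable_aboveM a F g (M : R) : continuous g -> (forall t, `|g t| <= M) ->
  circle_integrable (fun t => above a F t * g t).
Proof.
move=> cg gM; apply: (@bounded_integrable _ _ M).
  apply: measurable_funM; first exact: measurable_above.
  exact: continuous_measurable_fun.
move=> t; rewrite normrM -[leRHS]mul1r ler_pM//; exact: above_bound.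
Qed.

(** The layers where a < |F| <= b decrease to the empty set as b decreases to
    a. *)
Lemma thin_layer F (a e : R) : 0 < e -> exists b, [/\ a < b, b <= a + e &
  circle_int (above a F) - circle_int (above b F) <= e].
Proof.
move=> e0.
pose b n : R := a + e * harmonic n.
have bcvg : b n @[n --> \oo] --> a.
  rewrite -[X in _ --> X]addr0; apply: cvgD; first exact: cvg_cst.
  rewrite -[X in _ --> X](mulr0 e); apply: cvgM; first exact: cvg_cst.
  exact: cvg_harmonic.
have ab n : a < b n by rewrite ltrDl mulr_gt0 ?harmonic_gt0.
have bae n : b n <= a + e.
  by rewrite lerD2l ler_piMr ?(ltW e0)//= invf_le1 ?ler1n.
have /cvgrPdist_le /(_ _ e0) : circle_int (above (b n) F) @[n --> \oo] -->
    circle_int (above a F).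
  apply: (@circle_int_cvg _ _ _ 1) => [n|n t|t]; first exact: measurable_above.
    exact: above_bound.
  rewrite /above; have [na|an] := ltP a (normc F.[expi t]); last first.
    apply: cvg_near_cst; apply: nearW => n.
    by rewrite ltNge (le_trans an)// ltW.
  apply: cvg_near_cst; near=> n.
  have -> // : b n < normc F.[expi t].
  by near: n; exact: (cvgr_lt a).
move=> [n _ /(_ n (leqnn n)) H]; exists (b n); split => //.
by move: H; rewrite ler_norml => /andP[].
Unshelve. all: by end_near. Qed.

Definition rtrig (g : R -> R) := trigpoly (fun t => (g t)%:C).

Lemma rtrig_cst (a : R) : rtrig (fun=> a).
Proof. exact: trigpoly_cst. Qed.

Lemma rtrigD g h : rtrig g -> rtrig h -> rtrig (fun t => g t + h t).
Proof.
by move=> tg th; rewrite /rtrig; under eq_fun do rewrite rmorphD/=; exact: trigpolyD.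
Qed.

Lemma rtrigM g h : rtrig g -> rtrig h -> rtrig (fun t => g t * h t).
Proof.
by move=> tg th; rewrite /rtrig; under eq_fun do rewrite rmorphM/=; exact: trigpolyM.
Qed.

Lemma rtrigX g n : rtrig g -> rtrig (fun t => g t ^+ n).
Proof.
by move=> tg; rewrite /rtrig; under eq_fun do rewrite rmorphXn/=; exact: trigpolyX.
Qed.

Lemma rtrigB g h : rtrig g -> rtrig h -> rtrig (fun t => g t - h t).
Proof.
move=> tg th; under eq_fun do rewrite -mulN1r.
by apply: rtrigD => //; apply: rtrigM => //; exact: rtrig_cst.
Qed.

Lemma rtrig_sum (I : Type) (r : seq I) (g : I -> R -> R) :
  (forall i, rtrig (g i)) -> rtrig (fun t => \sum_(i <- r) g i t).
Proof.
move=> tg; rewrite /rtrig; under eq_fun do rewrite rmorph_sum/=.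
exact: trigpoly_sum.
Qed.

Lemma rtrig_cont g : rtrig g -> continuous g.
Proof. by move=> /trigpoly_cont[]. Qed.

Lemma exists_gt (ms : seq nat) : exists N, forall m, m \in ms -> (m < N)%N.
Proof.
exists (\max_(m <- ms) m).+1 => m mms; rewrite ltnS.
exact: (leq_bigmax_seq (F := id)).
Qed.

Let v F t := normc F.[expi t] ^+ 2.

Let v_ge F t : 2 / 5 <= normc F.[expi t] -> 4 / 25 <= v F t.
Proof. by rewrite /v => ?; nra. Qed.

Let v_le F t : v F t <= coef_norm F ^+ 2.
Proof.
rewrite lerXn2r// ?nnegrE ?normc_ge0 ?coef_norm_ge0//.
by apply: normc_horner_le; exact: normc_expi.
Qed.

(** As |F|^2 takes its values in an interval [c, C] with c > 0, the geometric
    series for C / |F|^2 in powers of 1 - |F|^2 / C converges uniformly. *)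
Lemma inv_rtrig_approx F (e : R) : (forall t, 2 / 5 <= normc F.[expi t]) ->
  0 < e -> exists p, rtrig p /\ forall t, `|(normc F.[expi t] ^+ 2)^-1 - p t| <= e.
Proof.
move=> F_ge e0; pose C := coef_norm F ^+ 2 + 1.
have C1 : 1 <= C by rewrite lerDr sqr_ge0.
have [J HJ] : exists J, (1 - 4 / 25 / C) ^+ J <= e * (4 / 25).
  apply: expr_le_eps; last by rewrite mulr_gt0//; lra.
  have : 0 < 4 / 25 / C by rewrite divr_gt0//; lra.
  have : 4 / 25 / C <= 1 by rewrite ler_pdivrMr; lra.
  by move=> ? ?; apply/andP; split; lra.
exists (fun t => C^-1 * \sum_(j < J) (1 - v F t / C) ^+ j); split.
  apply: rtrigM; first exact: rtrig_cst.
  apply: rtrig_sum => j; apply: rtrigX; apply: rtrigB; first exact: rtrig_cst.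
  by apply: rtrigM; [exact: trigpoly_normc_sqr|exact: rtrig_cst].
move=> t; have c0 : 0 < 4 / 25 :> R by lra.
have vC : v F t <= C by rewrite (le_trans (v_le F t))// lerDl.
apply: (le_trans (inv_geometric J c0 (v_ge (F_ge t)) vC)).
by rewrite ler_pdivrMr.
Qed.

(** The weight is rho times a cutoff polynomial evaluated at |F|^2 / C, so it
    is a trigonometric polynomial.  Between the two thresholds of the cutoff
    nothing is known about it; the last inequality still refers to the single
    threshold alpha since that layer has small measure. *)
Lemma cutoff_weight F (alpha rho eps : R) : (forall t, 2 / 5 <= normc F.[expi t]) ->
    0 < alpha -> 0 < rho -> rho <= 16^-1 -> 0 < eps ->
  exists w, [/\ rtrig w, forall t, 0 <= w t, forall t, w t <= rho,
    forall t, normc F.[expi t] <= alpha -> normc F.[expi t] * w t * 4 <= eps &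
    rho ^+ 2 / 4 * circle_int (fun t => above alpha F t * (normc F.[expi t] ^+ 2)^-1)
      <= circle_int (fun t => (normc F.[expi t] ^+ 2)^-1 * w t ^+ 2) + eps].
Proof.
move=> F_ge alpha0 rho0 rho16 eps0.
have [b [ab _ layer]] := thin_layer F alpha eps0.
have vg t := v_ge (F_ge t).
pose C := coef_norm F ^+ 2 + b ^+ 2 + 1.
have C0 : 0 < C.
  by have := sqr_ge0 (coef_norm F); have := sqr_ge0 b; rewrite /C; lra.
have x01 t : 0 <= v F t / C <= 1.
  rewrite divr_ge0 ?sqr_ge0 ?(ltW C0)//= ler_pdivrMr// mul1r.
  by have := v_le F t; have := sqr_ge0 b; rewrite /C; lra.
have [||||m [K cut]] := @cutoff_exponents R (alpha ^+ 2 / C) (b ^+ 2 / C)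
    (eps / (alpha + 1)).
- by rewrite divr_ge0 ?sqr_ge0 ?(ltW C0).
- by rewrite ltr_pM2r ?invr_gt0//; nra.
- by rewrite ler_pdivrMr// mul1r /C; have := sqr_ge0 (coef_norm F); lra.
- by rewrite divr_gt0//; lra.
pose T t := 1 - (1 - (v F t / C) ^+ m) ^+ K.
have T01 t : 0 <= T t <= 1 by have [] := cut _ (x01 t).
have Tsmall t : normc F.[expi t] <= alpha -> T t * (alpha + 1) <= eps.
  move=> Fa; have [_ h _] := cut _ (x01 t); rewrite -ler_pdivlMr; last lra.
  apply: h; rewrite ler_pM2r ?invr_gt0// lerXn2r// nnegrE ?normc_ge0//.
  exact: ltW.
have Tbig t : b < normc F.[expi t] -> 2^-1 <= T t.
  move=> bF; have [_ _ h] := cut _ (x01 t).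
  apply: h; rewrite ler_pM2r ?invr_gt0//.
  by rewrite lerXn2r// ?nnegrE ?normc_ge0 ?(ltW bF)//; lra.
have tT : rtrig T.
  apply: rtrigB; first exact: rtrig_cst.
  apply: rtrigX; apply: rtrigB; first exact: rtrig_cst.
  apply: rtrigX; apply: rtrigM; [exact: trigpoly_normc_sqr|exact: rtrig_cst].
clearbody T; clear cut x01 C0 C.
exists (fun t => rho * T t); split.
- by apply: rtrigM => //; exact: rtrig_cst.
- by move=> t; have /andP[h _] := T01 t; rewrite mulr_ge0// ltW.
- by move=> t; have /andP[_ h] := T01 t; rewrite ler_piMr// ltW.
- move=> t Fa; have /andP[h _] := T01 t; have := Tsmall t Fa => hTe.
  have FT : normc F.[expi t] * T t <= eps.
    by apply: le_trans hTe; rewrite mulrC ler_wpM2l//; lra.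
  have FT0 : 0 <= normc F.[expi t] * T t by rewrite mulr_ge0 ?normc_ge0.
  rewrite (_ : _ * 4 = rho * (normc F.[expi t] * T t) * 4); last by ring.
  have : rho * (normc F.[expi t] * T t) <= 16^-1 * (normc F.[expi t] * T t).
    by rewrite ler_wpM2r.
  lra.
have cT := rtrig_cont tT.
have cv : continuous (v F) by apply: rtrig_cont; exact: trigpoly_normc_sqr.
have cvi : continuous (fun t => (v F t)^-1).
  by apply: contV => // t; have := vg t; lra.
have v7 t : (v F t)^-1 <= 7.
  by rewrite -[leRHS]invrK lef_pV2 ?posrE//; have := vg t; lra.
have vi0 t : 0 <= (v F t)^-1 by rewrite invr_ge0; have := vg t; lra.
have v7' t : `|(v F t)^-1| <= 7 by rewrite ger0_norm.
have ia := integrable_aboveM alpha F cvi v7'.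
have la := integrable_above alpha F; have lb := integrable_above b F.
have iw : circle_integrable (fun t => (v F t)^-1 * (rho * T t) ^+ 2).
  by apply: cont_integrable; cont.
have r2 : 0 <= rho ^+ 2 / 4 by rewrite divr_ge0 ?sqr_ge0.
have key : rho ^+ 2 / 4 * circle_int (fun t => above alpha F t * (v F t)^-1) <=
    circle_int (fun t => (v F t)^-1 * (rho * T t) ^+ 2) +
    7 * (rho ^+ 2 / 4) * (circle_int (above alpha F) - circle_int (above b F)).
  rewrite -circle_intZ// -circle_intB// -circle_intZ; last exact: integrable_sub.
  rewrite -circle_intD//; last by apply: integrable_scale; exact: integrable_sub.
  apply: le_circle_int; first exact: integrable_scale.
    by apply: integrable_add => //; apply: integrable_scale; exact: integrable_sub.
  move=> t; have i0 := vi0 t; have i7 := v7 t.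
  have T2 : 0 <= (v F t)^-1 * (rho * T t) ^+ 2 by rewrite mulr_ge0 ?sqr_ge0.
  rewrite /above; have [aF|Fa] := ltP alpha (normc F.[expi t]).
    have [bF|Fb] := ltP b (normc F.[expi t]).
      rewrite subrr mulr0 addr0 mul1r mulrC ler_wpM2l// exprMn ler_wpM2l ?sqr_ge0//.
      by have := Tbig t bF => {la lb ia iw}; nra.
    rewrite mul1r subr0 mulr1 mulrC [7 * _]mulrC.
    have : (v F t)^-1 * (rho ^+ 2 / 4) <= 7 * (rho ^+ 2 / 4) by rewrite ler_wpM2r.
    by rewrite mulrC; lra.
  have -> : (b < normc F.[expi t]) = false by apply/negbTE; rewrite -leNgt; lra.
  by rewrite mul0r mulr0 subrr mulr0 addr0.
apply: (le_trans key); rewrite lerD2l.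
have r2' : 7 * (rho ^+ 2 / 4) <= 1.
  by have : rho * rho <= 16^-1 * 16^-1 := ler_pM (ltW rho0) (ltW rho0) rho16 rho16;
    rewrite expr2; lra.
apply: (@le_trans _ _ (7 * (rho ^+ 2 / 4) * eps)).
  by apply: ler_wpM2l => //; rewrite mulr_ge0.
by rewrite ler_piMl// ltW.
Qed.

(** All the means that enter the estimates of one increment vanish, or reduce
    to the mean of p w^2, for every large N: this is a finite number of
    instances of orthogonality. *)
Lemma carrier_moments (w p : R -> R) (g : R -> R[i]) Z :
    rtrig w -> rtrig p -> trigpoly g -> \sum_(i < size Z) normc Z`_i ^+ 2 = 1 ->
  exists D : nat, forall N, (D < N)%N ->
    let u t := (w t)%:C * (expi t ^+ N * Z.[expi t ^+ N]) in
    [/\ circle_int (fun t => Re (u t)) = 0, circle_int (fun t => Re (u t ^+ 2)) = 0,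
        circle_int (fun t => p t * Re (u t)) = 0,
        circle_int (fun t => p t * Re (u t ^+ 2)) = 0 &
        circle_int (fun t => p t * normc (u t) ^+ 2)
          = circle_int (fun t => p t * w t ^+ 2)] /\
    circle_int (fun t => Re (g t * u t)) = 0 /\
    circle_int (fun t => Re (g t * u t ^+ 2)) = 0.
Proof.
move=> tw tp tg Z1; have tw2 := rtrigX 2 tw.
have [Y HY] := normc_horner_sqr Z.
have [D1 o1] := circle_int_high_freq tw.
have [D2 o2] := circle_int_high_freq tw2.
have [D3 o3] := circle_int_high_freq (rtrigM tp tw).
have [D4 o4] := circle_int_high_freq (rtrigM tp tw2).
have [D5 o5] := circle_int_high_freq (trigpolyM tg tw).
have [D6 o6] := circle_int_high_freq (trigpolyM tg tw2).
have [D HD] := exists_gt [:: D1; D2; D3; D4; D5; D6].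
exists D => N DN u.
have NP m : m \in [:: D1; D2; D3; D4; D5; D6] -> (m < N)%N.
  by move=> /HD mD; exact: ltn_trans mD DN.
have unitN t : normc (expi t ^+ N) = 1 by rewrite normcX normc_expi expr1n.
have u2E t : u t ^+ 2 =
    (w t ^+ 2)%:C * (expi t ^+ N * ('X * Z ^+ 2).[expi t ^+ N]).
  by rewrite rmorphXn/= hornerM hornerX horner_exp /u; ring.
have ReCM (a : R) (z : R[i]) : Re (a%:C * z) = a * Re z.
  by rewrite ReM/= mul0r subr0.
split; [split|split].
- by apply: o1; apply: NP; rewrite !inE eqxx ?orbT.
- under [X in circle_int X]funext do rewrite u2E.
  by apply: o2; apply: NP; rewrite !inE eqxx ?orbT.
- under [X in circle_int X]funext do rewrite -ReCM mulrA -rmorphM.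
  by apply: o3; apply: NP; rewrite !inE eqxx ?orbT.
- under [X in circle_int X]funext do rewrite u2E -ReCM mulrA -rmorphM.
  by apply: o4; apply: NP; rewrite !inE eqxx ?orbT.
- have E t : p t * normc (u t) ^+ 2 = p t * w t ^+ 2 +
      2 * Re ((p t * w t ^+ 2)%:C * (expi t ^+ N * Y.[expi t ^+ N])).
    rewrite /u normcM normc_real normcM unitN mul1r exprMn HY// Z1.
    by rewrite real_normK ?num_real// ReCM; ring.
  under [X in circle_int X]funext do rewrite E.
  have w_cont := rtrig_cont tw; have p_cont := rtrig_cont tp.
  have [cY _] : ccont (fun t => (p t * w t ^+ 2)%:C * (expi t ^+ N * Y.[expi t ^+ N])).
    apply: ccontM; first by apply: ccont_real; cont.
    apply: ccontM; first by apply: ccontX; exact: ccont_expi.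
    by apply: ccont_horner; apply: ccontX; exact: ccont_expi.
  rewrite circle_intD; [|by apply: cont_integrable; cont..].
  rewrite circle_intZ; last by apply: cont_integrable; cont.
  by rewrite (o4 N Y) ?mulr0 ?addr0// NP// !inE eqxx ?orbT.
- under [X in circle_int X]funext do rewrite mulrA.
  by apply: o5; apply: NP; rewrite !inE eqxx ?orbT.
- under [X in circle_int X]funext do rewrite u2E mulrA.
  by apply: o6; apply: NP; rewrite !inE eqxx ?orbT.
Qed.

(** The degrees of F and of the new polynomial are bounded by s and by the new
    s, so that F is a partial sum of the latter.  The last three fields are
    the effect on the mean of the logarithm, which excludes escape to
    infinity, on the mean of 1 / |F|^2, which forces stopping, and on the
    coefficient of 1/F that will show that the limit is not in H^2. *)
Record refines (alpha rho eps : R) F s F' s' : Prop := Refines {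
  refines_lt : (s < s')%N;
  refines_size : (size F' <= s')%N;
  refines_take : take_poly s F' = F;
  refines_move : forall t,
    normc (F'.[expi t] - F.[expi t]) <= 4 * rho * normc F.[expi t];
  refines_stop : forall t m, (s <= m)%N -> normc F.[expi t] <= alpha ->
    normc ((take_poly m F').[expi t] - F.[expi t]) <= eps;
  refines_ln : circle_int (fun t => ln (normc F'.[expi t] ^+ 2)) <=
    circle_int (fun t => ln (normc F.[expi t] ^+ 2)) + 768 * rho ^+ 3 * (2 * pi);
  refines_inv : circle_int (fun t => (normc F.[expi t] ^+ 2)^-1)
    + rho ^+ 2 / 4
      * circle_int (fun t => above alpha F t * (normc F.[expi t] ^+ 2)^-1)
    - 7168 * rho ^+ 3 * (2 * pi) - eps
    <= circle_int (fun t => (normc F'.[expi t] ^+ 2)^-1);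
  refines_coef : `|circle_int (fun t => Re (conjc (expi t) / F'.[expi t]))
      - circle_int (fun t => Re (conjc (expi t) / F.[expi t]))|
    <= 320 * rho ^+ 3 * (2 * pi) + eps }.

(** The order of the choices matters: first the cutoff w, then the
    trigonometric polynomial approximating 1 / |F|^2, then Z with coefficients
    small compared with those of F w, and finally the frequency N. *)
Lemma refinement F s (alpha rho eps : R) :
    (forall t, 2 / 5 <= normc F.[expi t]) -> (size F <= s)%N ->
    0 < alpha -> 0 < rho -> rho <= 16^-1 -> 0 < eps ->
  exists F' s', refines alpha rho eps F s F' s'.
Proof.
move=> F_ge sF alpha0 rho0 rho16 eps0.
have eps20 : 0 < eps / 2 by rewrite divr_gt0.
have rho0' := ltW rho0.
pose B := coef_norm F; have B0 : 0 <= B := coef_norm_ge0 F.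
have FB t : normc F.[expi t] <= B by apply: normc_horner_le; exact: normc_expi.
have [w [tw w_ge0 w_le w_small w_gain]] :=
  cutoff_weight F_ge alpha0 rho0 rho16 eps20.
have pi0 := @pi2_gt0 R.
(* The error e of p counts twice in the mean of 1 / |F'|^2, and with the
   bound B of |F| as a factor in the mean of e^(-it) / F'. *)
pose e := eps / (2 * pi * (4 + B)).
have e0 : 0 < e by rewrite divr_gt0// mulr_gt0//; lra.
have eE : e * (2 * pi) * (4 + B) = eps.
  by rewrite /e -mulrA divfK// mulf_neq0// gt_eqF//; lra.
have [p [tp pe]] := inv_rtrig_approx F_ge e0.
pose g t := conjc (expi t) * conjc F.[expi t] * (p t)%:C.
have tg : trigpoly g.
  apply: trigpolyM => //; apply: trigpolyM; first exact: trigpoly_conj_expi.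
  exact: trigpoly_conj_horner.
have [d [Q HQ]] : trigpoly (fun t => F.[expi t] * (w t)%:C).
  by apply: trigpolyM => //; exact: trigpoly_horner.
have A0 := coef_norm_ge0 Q.
pose kappa := eps / (2 * (coef_norm Q + 1)).
have kappa0 : 0 < kappa by rewrite divr_gt0// mulr_gt0//; lra.
have kA : kappa * coef_norm Q <= eps / 2.
  rewrite /kappa invfM mulrA -mulrA ger_pMr ?divr_gt0//.
  by rewrite mulrC ler_pdivrMr ?mul1r; lra.
have [Z [Zk Z1 Zpart]] := flat_poly kappa0.
have [D mom] := carrier_moments tw tp tg Z1.
have [N NP] := exists_gt [:: d + size Q; d + s; D]%N.
have dQN : (d + size Q <= N)%N by apply/ltnW/NP; rewrite !inE eqxx.
have dsN : (d + s <= N)%N by apply/ltnW/NP; rewrite !inE eqxx orbT.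
have dN : (d <= N)%N by exact: leq_trans (leq_addr _ _) dsN.
have DN : (D < N)%N by apply: NP; rewrite !inE eqxx !orbT.
have [[I1 I2 I3 I4 I5] [I6 I7]] := mom N DN.
pose F' := F + blocks Z Q d N (size Z).
pose G t := expi t ^+ N * Z.[expi t ^+ N].
have unitN t : normc (expi t ^+ N) = 1 by rewrite normcX normc_expi expr1n.
have G_le t : normc (G t) <= 4.
  by rewrite /G normcM unitN mul1r -[Z in Z.[_]](take_poly_id (leqnn (size Z))) Zpart.
have G_cont : ccont G.
  apply: ccontM; first by apply: ccontX; exact: ccont_expi.
  by apply: ccont_horner; apply: ccontX; exact: ccont_expi.
have F'E t : F'.[expi t] = F.[expi t] * (1 + (w t)%:C * G t).
  rewrite /F' hornerD (horner_blocks Z (size Z) dN (normc_expi t) (HQ t)).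
  by rewrite take_poly_id// /G; ring.
have w_cont := rtrig_cont tw; have p_cont := rtrig_cont tp.
exists F', (maxn s.+1 (size F')); split.
- exact: leq_maxl.
- exact: leq_maxr.
- by rewrite /F' take_polyD (take_blocks0 _ _ _ dsN) addr0 take_poly_id.
- move=> t; rewrite F'E mulrDr mulr1 addrAC subrr add0r normcM mulrC.
  rewrite ler_wpM2r ?normc_ge0//.
  exact: (normc_incr_le w_ge0 w_le G_le).
- move=> t k sk Fa.
  rewrite /F' take_polyD take_poly_id ?(leq_trans sF)// hornerD addrAC subrr add0r.
  have [j Hj] := @take_blocks _ Z Q d N (size Z) k kappa (expi t) _ dQN (ltW kappa0)
    Zk (normc_expi t) (HQ t).
  rewrite -[X in normc X](subrK (F.[expi t] * (w t)%:C *
    (expi t ^+ N * (take_poly j Z).[expi t ^+ N]))) (le_trans (ler_normcD _ _))//.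
  rewrite [leRHS](splitr eps) lerD ?(le_trans Hj)//.
  apply: le_trans (w_small t Fa).
  rewrite normcM [normc (F.[_] * _)]normcM [normc (_ * (take_poly _ _).[_])]normcM.
  rewrite unitN mul1r normc_real (ger0_norm (w_ge0 t)) ler_wpM2l ?Zpart//.
  by rewrite mulr_ge0 ?normc_ge0.
- exact: (incr_ln F_ge rho0' rho16 w_ge0 w_le w_cont G_cont G_le F'E).
- have := incr_inv F_ge rho0' rho16 w_ge0 w_le w_cont G_cont G_le F'E p_cont pe I3 I4 I5.
  apply: le_trans.
  have : 2 * e * (2 * pi) <= eps / 2.
    have : 0 <= e * (2 * pi) * B.
      by apply: mulr_ge0 => //; apply: mulr_ge0; exact: ltW.
    by move: eE; rewrite mulrDr; lra.
  by move: w_gain; rewrite mulrDl; lra.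
- have := incr_coef F_ge rho0' rho16 w_ge0 w_le w_cont G_cont G_le F'E p_cont pe FB I6 I7.
  move/le_trans; apply; rewrite mulrDl lerD2l.
  have : 0 <= e * (2 * pi) by apply: mulr_ge0; exact: ltW.
  by move: eE; rewrite mulrDr; lra.
Qed.

End Step.

(** * The sequence of stages *)

Section Construction.
Context {R : realType}.
Implicit Types (F P Q Z : {poly R[i]}).

(** One small constant serves as the first step size and as the total
    tolerance. *)
Definition step0 : R := 10^-1 ^+ 3.
Definition tolerance n : R := step0 * 2^-1 ^+ n.+1.
(** The sum of the tolerances of the stages before n. *)
Definition drift n : R := step0 * (1 - 2^-1 ^+ n).
(** The stopping level increases by the tolerance of each stage, so that a
    stopped point remains stopped although it still moves a little. *)
Definition stop_level n : R := 2^-1 + drift n.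
Definition step_size n : R := step0 / Num.sqrt n.+1%:R.

Lemma step0_gt0 : 0 < step0. Proof. by rewrite exprn_gt0// invr_gt0. Qed.

Lemma step0E : 1000 * step0 = 1.
Proof. have ten : 10 != 0 :> R by rewrite pnatr_eq0. by rewrite /step0; field. Qed.

Lemma half_ge0 n : 0 <= 2^-1 ^+ n :> R.
Proof. by rewrite exprn_ge0// invr_ge0. Qed.

Lemma half_le1 n : 2^-1 ^+ n <= 1 :> R.
Proof. by rewrite exprn_ile1 ?invr_ge0// invf_le1 ?ler1n. Qed.

Lemma tolerance_gt0 n : 0 < tolerance n.
Proof. by rewrite mulr_gt0 ?step0_gt0// exprn_gt0// invr_gt0. Qed.

Lemma driftS n : drift n.+1 = drift n + tolerance n.
Proof. by rewrite /drift /tolerance exprS -mulrDr; congr (_ * _); lra. Qed.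

Lemma drift_ge0 n : 0 <= drift n.
Proof. by rewrite mulr_ge0 ?(ltW step0_gt0)// subr_ge0 half_le1. Qed.

Lemma drift_le n : drift n <= step0.
Proof. by rewrite ler_piMr ?(ltW step0_gt0)// gerBl half_ge0. Qed.

Lemma sqrt_ge1 n : 1 <= Num.sqrt n.+1%:R :> R.
Proof. by rewrite -[leLHS]sqrtr1 ler_wsqrtr// ler1n. Qed.

Lemma step_size_gt0 n : 0 < step_size n.
Proof. by rewrite divr_gt0 ?step0_gt0// (lt_le_trans _ (sqrt_ge1 n)). Qed.

Lemma step_size_le n : step_size n <= step0.
Proof.
rewrite ler_pdivrMr ?(lt_le_trans _ (sqrt_ge1 n))//.
by rewrite ler_peMr ?(ltW step0_gt0)// sqrt_ge1.
Qed.

Lemma step_size_sqr n : step_size n ^+ 2 = step0 ^+ 2 * n.+1%:R^-1.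
Proof. by rewrite /step_size expr_div_n sqr_sqrtr. Qed.

(** Telescoping: with a = sqrt (m + 1) and b = sqrt (m + 2), the number b^(-3)
    is at most 2 / a - 2 / b, because b - a = 1 / (a + b). *)
Lemma sum_step_size3 n : \sum_(k < n) step_size k ^+ 3 <= 3 * step0 ^+ 3.
Proof.
have r3 : 0 < step0 ^+ 3 by rewrite exprn_gt0// step0_gt0.
suff H m : \sum_(k < m.+1) step_size k ^+ 3 <= step0 ^+ 3 * (3 - 2 / Num.sqrt m.+1%:R).
  case: n => [|n]; first by rewrite big_ord0 mulr_ge0// ltW.
  apply: (le_trans (H n)); rewrite mulrC ler_pM2r// gerBl divr_ge0 ?sqrtr_ge0//.
elim: m => [|m IH].
  by rewrite big_ord1 /step_size sqrtr1 !divr1; lra.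
rewrite big_ord_recr/=; apply: (le_trans (lerD IH (lexx _))).
have := sqrt_ge1 m; have := sqrt_ge1 m.+1; rewrite /step_size.
have : Num.sqrt m.+1%:R <= Num.sqrt m.+2%:R :> R by rewrite ler_sqrt// ler_nat.
have : Num.sqrt m.+1%:R ^+ 2 + 1 = Num.sqrt m.+2%:R ^+ 2 :> R.
  by rewrite !sqr_sqrtr// natr1.
move: (Num.sqrt m.+1%:R) (Num.sqrt m.+2%:R) => a b ab1 ab b1 a1.
rewrite expr_div_n -mulrDr ler_pM2l//.
suff : (b ^+ 3)^-1 <= 2 / a - 2 / b by lra.
have a0 : 0 < a by lra. have b0 : 0 < b by lra.
have -> : 2 / a - 2 / b = 2 * (b - a) / (a * b) by field; lra.
have -> : b - a = (b + a)^-1.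
  apply: (mulIf (x := b + a)); first by rewrite gt_eqF//; lra.
  rewrite mulVf ?gt_eqF//; last lra.
  have -> : (b - a) * (b + a) = b ^+ 2 - a ^+ 2 by ring.
  lra.
have -> : 2 / (b + a) / (a * b) = ((b + a) * (a * b) / 2)^-1 by field; lra.
rewrite lef_pV2 ?posrE ?exprn_gt0// ?divr_gt0// ?mulr_gt0//; last lra.
have : (b + a) * (a * b) <= (b + b) * (b * b).
  by apply: ler_pM; try nra.
rewrite !exprS expr0; lra.
Qed.

Definition start_poly : {poly R[i]} := 1 + (4^-1)%:C *: 'X.

Record stages (F : nat -> {poly R[i]}) (s : nat -> nat) : Prop := Stages {
  stages_start : F 0 = start_poly;
  stages_size : forall n, (size (F n) <= s n)%N;
  stages_ge : forall n t, 2^-1 - 3 * step0 <= normc (F n).[expi t];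
  stages_refines : forall n,
    refines (stop_level n) (step_size n) (tolerance n) (F n) (s n) (F n.+1) (s n.+1) }.

Lemma horner_start_poly t : start_poly.[expi t] = 1 + (4^-1)%:C * expi t.
Proof. by rewrite /start_poly hornerD hornerC hornerZ hornerX. Qed.

Lemma start_poly_ge t : 3 / 4 <= normc start_poly.[expi t].
Proof.
have := ler_normcB 1 (- ((4^-1)%:C * expi t)); rewrite opprK -horner_start_poly.
by rewrite normc1 normc_neg normcM normc_real normc_expi ger0_norm ?invr_ge0//; lra.
Qed.

(** Starting above 1/2, a point can jump over the level 1/2 by at most 2
    step0, and then only the tolerances accumulate. *)
Definition good_stage n (x : {poly R[i]} * nat) :=
  (size x.1 <= x.2)%N /\
  forall t, 2^-1 - 2 * step0 - drift n <= normc x.1.[expi t].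

Definition next_stage n (x y : {poly R[i]} * nat) :=
  refines (stop_level n) (step_size n) (tolerance n) x.1 x.2 y.1 y.2.

Lemma good_stage_next n x : good_stage n x -> exists y, next_stage n x y.
Proof.
move=> [sx gx]; have dr := drift_le n; have d0 := drift_ge0 n.
have [||||||F' [s' H]] := @refinement R x.1 x.2 (stop_level n) (step_size n) (tolerance n).
- by move=> t; have := gx t; have := step0E; lra.
- exact: sx.
- by rewrite /stop_level; lra.
- exact: step_size_gt0.
- by have := step_size_le n; have := step0E; lra.
- exact: tolerance_gt0.
by exists (F', s').
Qed.

Lemma next_stage_good n x y : good_stage n x -> next_stage n x y -> good_stage n.+1 y.
Proof.
move=> [sx gx] [xy sy _ mv small _ _ _]; split => // t.
rewrite driftS; have d0 := drift_ge0 n.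
have [Fs|sF] := leP (normc x.1.[expi t]) (stop_level n).
  have := small t y.2 (ltnW xy) Fs; rewrite take_poly_id// => h.
  have := ler_normcB x.1.[expi t] (x.1.[expi t] - y.1.[expi t]).
  rewrite subKr normcBC; have := gx t; lra.
have := ler_normcB x.1.[expi t] (x.1.[expi t] - y.1.[expi t]).
rewrite subKr normcBC; have := mv t; have := step_size_le n; have := step_size_gt0 n.
have e0 := tolerance_gt0 n.
rewrite /stop_level in sF; have := step0E; nra.
Qed.

Lemma stages_exist : exists (F : nat -> {poly R[i]}) s, stages F s.
Proof.
have /choice[nx Hnx] : forall p : nat * ({poly R[i]} * nat), exists y,
    good_stage p.1 p.2 -> next_stage p.1 p.2 y.
  move=> [n x]; have [/good_stage_next[y Hy]|ng] := pselect (good_stage n x).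
    by exists y.
  by exists x => /ng.
pose X := fix X n := if n is n'.+1 then nx (n', X n') else (start_poly, size start_poly).
have gX n : good_stage n (X n).
  elim: n => [|n IH]; last exact: next_stage_good IH (Hnx (n, X n) IH).
  split => //= t; rewrite /drift expr0 subrr mulr0; have := start_poly_ge t.
  by have := step0E; lra.
have nX n : next_stage n (X n) (X n.+1) by exact: (Hnx (n, X n) (gX n)).
exists (fst \o X), (snd \o X); split => //= n; first by have [] := gX n.
by move=> t; have [_ /(_ t)] := gX n; have := drift_le n; lra.
Qed.

End Construction.

(** * Almost every point is stopped *)

Section Limit.
Context {R : realType}.
Variables (F : nat -> {poly R[i]}) (s : nat -> nat).
Hypothesis Fs : stages F s.

Let f n t := (F n).[expi t].
Local Notation step0 := (@step0 R).

Lemma stage_ge n t : 2 / 5 <= normc (f n t).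
Proof. by have := stages_ge Fs n t; have := @step0E R; rewrite /f; lra. Qed.

Lemma stage_cont n : ccont (f n).
Proof. by apply: ccont_horner; exact: ccont_expi. Qed.

Lemma sum_step_size3_pi n :
  0 <= (3 * step0 ^+ 3 - \sum_(k < n) step_size k ^+ 3) * (2 * pi).
Proof. by apply: mulr_ge0; [rewrite subr_ge0; exact: sum_step_size3|exact/ltW/pi2_gt0]. Qed.

Lemma mean_ln n : circle_int (fun t => ln (normc (f n t) ^+ 2)) <=
  circle_int (fun t => ln (normc (f 0 t) ^+ 2)) + 768 * (3 * step0 ^+ 3) * (2 * pi).
Proof.
have pi0 := @pi2_gt0 R.
have H : circle_int (fun t => ln (normc (f n t) ^+ 2)) <=
    circle_int (fun t => ln (normc (f 0 t) ^+ 2))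
      + 768 * (\sum_(k < n) step_size k ^+ 3) * (2 * pi).
  elim: n => [|n IH]; first by rewrite big_ord0 mulr0 mul0r addr0.
  rewrite big_ord_recr/= mulrDr mulrDl addrA.
  by apply: (le_trans (refines_ln (stages_refines Fs n))); rewrite lerD2r.
by apply: (le_trans H); rewrite lerD2l; have := sum_step_size3_pi n; lra.
Qed.

Lemma mean_coef n : `|circle_int (fun t => Re (conjc (expi t) / f n t))
   - circle_int (fun t => Re (conjc (expi t) / f 0 t))|
  <= 320 * (3 * step0 ^+ 3) * (2 * pi) + step0.
Proof.
have pi0 := @pi2_gt0 R.
have H : `|circle_int (fun t => Re (conjc (expi t) / f n t))
    - circle_int (fun t => Re (conjc (expi t) / f 0 t))|
    <= 320 * (\sum_(k < n) step_size k ^+ 3) * (2 * pi) + drift n.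
  elim: n => [|n IH].
    rewrite subrr normr0 big_ord0 mulr0 mul0r add0r; exact: drift_ge0.
  rewrite big_ord_recr/= mulrDr mulrDl driftS.
  have := refines_coef (stages_refines Fs n); rewrite -/(f n _) -/(f n.+1 _).
  pose J k := circle_int (fun t => Re (conjc (expi t) / f k t)).
  rewrite -/(J 0) -/(J n) -/(J n.+1) in IH * => h.
  by have := ler_distD (J n) (J n.+1) (J 0); lra.
apply: (le_trans H); have := @drift_le R n; have := sum_step_size3_pi n.
lra.
Qed.

Lemma stage_neq0 n t : f n t != 0.
Proof. by rewrite -normc_gt0; have := stage_ge n t; lra. Qed.

Lemma cont_stage_sqr n : continuous (fun t => normc (f n t) ^+ 2).
Proof. by apply: continuous_normc_sqr; exact: stage_cont. Qed.

Lemma v_ge n t : 4 / 25 <= normc (f n t) ^+ 2.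
Proof. by have := stage_ge n t; nra. Qed.

Lemma stage_sqr_gt0 n t : 0 < normc (f n t) ^+ 2.
Proof. by have := v_ge n t; lra. Qed.

Lemma inv_stage_sqr_bound n t : `|(normc (f n t) ^+ 2)^-1| <= 7.
Proof.
rewrite ger0_norm ?invr_ge0 ?sqr_ge0//.
by rewrite -[leRHS]invrK lef_pV2 ?posrE ?stage_sqr_gt0//; have := v_ge n t; lra.
Qed.

Lemma cont_inv_stage_sqr n : continuous (fun t => (normc (f n t) ^+ 2)^-1).
Proof. by apply: contV; [exact: cont_stage_sqr|move=> t; rewrite gt_eqF// stage_sqr_gt0]. Qed.

Definition active n t := above (stop_level n) (F n) t.

Lemma integrable_active_inv_sqr n :
  circle_integrable (fun t => active n t * (normc (f n t) ^+ 2)^-1).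
Proof. by apply: (integrable_aboveM _ _ (M := 7)); [exact: cont_inv_stage_sqr|exact: inv_stage_sqr_bound]. Qed.

(** The means of 1 / |f_n|^2 telescope and stay bounded. *)
Lemma sum_gain n : \sum_(k < n) step_size k ^+ 2 / 4 *
    circle_int (fun t => active k t * (normc (f k t) ^+ 2)^-1)
  <= 7 * (2 * pi) + 7168 * (3 * step0 ^+ 3) * (2 * pi) + step0.
Proof.
have pi0 := @pi2_gt0 R.
have H : circle_int (fun t => (normc (f 0 t) ^+ 2)^-1) + \sum_(k < n) step_size k ^+ 2 / 4 *
    circle_int (fun t => active k t * (normc (f k t) ^+ 2)^-1)
    - 7168 * (\sum_(k < n) step_size k ^+ 3) * (2 * pi) - drift n
    <= circle_int (fun t => (normc (f n t) ^+ 2)^-1).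
  elim: n => [|n IH].
    by rewrite !big_ord0 mulr0 mul0r addr0 subr0 gerBl; exact: drift_ge0.
  rewrite !big_ord_recr/= mulrDr mulrDl driftS.
  have := refines_inv (stages_refines Fs n); rewrite -/(f n _) -/(f n.+1 _) -/(active n _).
  by move: IH; lra.
have I7 : circle_int (fun t => (normc (f n t) ^+ 2)^-1) <= 7 * (2 * pi).
  rewrite -circle_int_cst; apply: le_circle_int.
  - by apply: cont_integrable; exact: cont_inv_stage_sqr.
  - exact: integrable_cst.
  - by move=> t; have := inv_stage_sqr_bound n t; rewrite ler_norml => /andP[].
have I0 : 0 <= circle_int (fun t => (normc (f 0 t) ^+ 2)^-1).
  have := circle_int_cst (0 : R); rewrite mul0r => <-.
  apply: le_circle_int.
  - exact: integrable_cst.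
  - by apply: cont_integrable; exact: cont_inv_stage_sqr.
  - by move=> t; rewrite invr_ge0 sqr_ge0.
have := sum_step_size3_pi n; have := @drift_le R n; lra.
Qed.

(** By convexity 1 / v = e^(- ln v) lies above its tangent at ln v = K, so
    that the bound on the mean of the logarithm gives a lower bound for the
    mean of 1 / v over the active set.  The constant 6 makes ln v + 6
    nonnegative outside this set. *)
Lemma active_gain K n :
  expR (- K) * ((1 + K) * circle_int (active n)
    - circle_int (fun t => ln (normc (f n t) ^+ 2)) - 6 * (2 * pi))
  <= circle_int (fun t => active n t * (normc (f n t) ^+ 2)^-1).
Proof.
have cl : continuous (fun t => ln (normc (f n t) ^+ 2)).
  by apply: cont_ln; [exact: cont_stage_sqr|exact: stage_sqr_gt0].
have ic := integrable_above (stop_level n) (F n).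
have il := cont_integrable cl; have i6 := @integrable_cst R 6.
rewrite -circle_int_cst -circle_intZ// -circle_intB//; last exact: integrable_scale.
rewrite -circle_intB//; last by apply: integrable_sub => //; exact: integrable_scale.
have ih : circle_integrable (fun t => (1 + K) * active n t
    - ln (normc (f n t) ^+ 2) - 6).
  by apply: integrable_sub => //; apply: integrable_sub => //; exact: integrable_scale.
rewrite -circle_intZ//.
apply: le_circle_int; [exact: integrable_scale|exact: integrable_active_inv_sqr|].
move=> t; have v0 := stage_sqr_gt0 n t; have e0 := expR_gt0 (- K).
have vE : (normc (f n t) ^+ 2)^-1 = expR (- ln (normc (f n t) ^+ 2)).
  by rewrite expRN lnK.
rewrite /active /above; case: ltP => _; last first.
  rewrite mulr0 mul0r pmulr_rle0// sub0r.
  suff h : - ln (normc (f n t) ^+ 2) <= 6 by lra.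
  have : -1 < (normc (f n t) ^+ 2)^-1 - 1.
    have : 0 < (normc (f n t) ^+ 2)^-1 by rewrite invr_gt0.
    by lra.
  move=> /le_ln1Dx; rewrite addrC subrK lnV ?posrE// => /le_trans; apply.
  by have := inv_stage_sqr_bound n t; rewrite ler_norml => /andP[_]; lra.
rewrite mulr1 mul1r vE.
have -> : - ln (normc (f n t) ^+ 2) = - K + (K - ln (normc (f n t) ^+ 2)).
  by rewrite addrA addNr add0r.
rewrite expRD ler_pM2l//; apply: (le_trans _ (expR_ge1Dx _)); lra.
Qed.

Lemma stopped_step n t : normc (f n t) <= stop_level n ->
  normc (f n.+1 t - f n t) <= tolerance n.
Proof.
move=> st; have := refines_stop (stages_refines Fs _) (ltnW (refines_lt (stages_refines Fs n))) st.
by rewrite take_poly_id//; exact: stages_size.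
Qed.

Lemma stopped_succ n t : normc (f n t) <= stop_level n -> normc (f n.+1 t) <= stop_level n.+1.
Proof.
move=> st; have := stopped_step st; rewrite /stop_level driftS => h.
have := ler_normcD (f n.+1 t - f n t) (f n t); rewrite subrK.
by move: st; rewrite /stop_level; lra.
Qed.

Lemma active_le n t : active n.+1 t <= active n t.
Proof.
rewrite /active /above; have [//|] := ltP (stop_level n) (normc (F n).[expi t]).
  by rewrite ler_nat leq_b1.
by move=> /stopped_succ; rewrite leNgt => /negbTE ->.
Qed.

Lemma stop_forever n m t : (n <= m)%N ->
  normc (f n t) <= stop_level n -> normc (f m t) <= stop_level m.
Proof.
move=> nm st; rewrite -(subnKC nm); elim: (m - n)%N => [|k IH].
  by rewrite addn0.
by rewrite addnS; exact: stopped_succ.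
Qed.

Lemma active_decr n m : (n <= m)%N ->
  circle_int (active m) <= circle_int (active n).
Proof.
move=> nm; rewrite -(subnKC nm); elim: (m - n)%N => [|k IH].
  by rewrite addn0.
rewrite addnS; apply: le_trans IH; apply: le_circle_int.
- exact: integrable_above.
- exact: integrable_above.
- by move=> t; exact: active_le.
Qed.

(** If the active sets had measure at least e at every stage, each stage would
    gain a fixed multiple of 1 / (n + 1), against the divergence of the
    harmonic series. *)
Lemma active_small (e : R) : 0 < e -> exists n, circle_int (active n) <= e.
Proof.
move=> e0; apply: contrapT => /forallNP H.
have {}H n : e < circle_int (active n) by rewrite ltNge; apply/negP/H.
pose L := circle_int (fun t => ln (normc (f 0 t) ^+ 2))
  + 768 * (3 * step0 ^+ 3) * (2 * pi) + 6 * (2 * pi).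
(* This choice makes the lower bound of [active_gain] at least expR (- K) * e. *)
pose K := `|L| / e.
have Kge : 0 <= K by rewrite divr_ge0// ltW.
have W n : expR (- K) * e <= circle_int (fun t => active n t * (normc (f n t) ^+ 2)^-1).
  apply: (le_trans _ (active_gain K n)); rewrite ler_pM2l ?expR_gt0//.
  have Ke : K * e = `|L| by rewrite /K divfK// gt_eqF.
  have : K * e <= K * circle_int (active n) by rewrite ler_wpM2l// ltW.
  have := mean_ln n; have := ler_norm L; have := H n; rewrite {1}/L Ke; lra.
pose w := step0 ^+ 2 / 4 * (expR (- K) * e).
have rate0 : 0 < step0 by exact: step0_gt0.
have w0 : 0 < w.
  by rewrite mulr_gt0 ?mulr_gt0 ?expR_gt0// ?divr_gt0 ?exprn_gt0.
pose T := 7 * (2 * pi) + 7168 * (3 * step0 ^+ 3) * (2 * pi) + step0.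
have bd n : \sum_(k < n) k.+1%:R^-1 <= T / w.
  rewrite ler_pdivlMr//; apply: (le_trans _ (sum_gain n)).
  rewrite mulr_suml; apply: ler_sum => k _.
  rewrite step_size_sqr (_ : _ * w = step0 ^+ 2 / k.+1%:R / 4 * (expR (- K) * e)).
    by rewrite ler_wpM2l// !divr_ge0// sqr_ge0.
  by rewrite /w; ring.
apply: (@dvg_harmonic R); apply: nondecreasing_is_cvgn.
  by apply/nondecreasing_seqP => n; rewrite seriesSr lerDl; exact: harmonic_ge0.
exists (T / w) => _ [n _ <-]; rewrite seriesEord/=; exact: bd.
Qed.

End Limit.

(** * Limits of sequences with geometric increments *)

Section Geometric.
Context {R : realType}.
Implicit Types (c : R) (n : nat).

(** The sequences x_k - c 2^(-k) and x_k + c 2^(-k) are monotone and enclose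
    x_k. *)
Lemma geometric_cvg (x : nat -> R) c n :
  (forall k, (n <= k)%N -> `|x k.+1 - x k| <= c * 2^-1 ^+ k.+1) ->
  cvgn x /\ forall k, (n <= k)%N -> `|x k - limn x| <= c * 2^-1 ^+ k.
Proof.
move=> H.
pose y k := x (k + n)%N - c * 2^-1 ^+ (k + n).
pose z k := x (k + n)%N + c * 2^-1 ^+ (k + n).
have Hk k : `|x (k + n).+1 - x (k + n)%N| <= c * 2^-1 ^+ (k + n) / 2.
  by rewrite (le_trans (H _ (leq_addl _ _)))// exprSr mulrA.
have c0 k : 0 <= c * 2^-1 ^+ (k + n).
  have := le_trans (normr_ge0 _) (Hk k); lra.
have ny : nondecreasing_seq y.
  apply/nondecreasing_seqP => k; rewrite /y addSn exprSr mulrA.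
  by have := Hk k; rewrite ler_norml => /andP[]; lra.
have nz : nonincreasing_seq z.
  apply/nonincreasing_seqP => k; rewrite /z addSn exprSr mulrA.
  by have := Hk k; rewrite ler_norml => /andP[]; lra.
have yz k l : y k <= z l.
  have yzk j : y j <= z j by rewrite /y /z; have := c0 j; lra.
  have [kl|/ltnW lk] := leqP k l.
    exact: le_trans (ny _ _ kl) (yzk l).
  exact: le_trans (yzk k) (nz _ _ lk).
have cy : cvgn y.
  apply: nondecreasing_is_cvgn => //.
  by exists (z 0%N) => _ [k _ <-].
have h0 : (fun k => c * 2^-1 ^+ (k + n)) @ \oo --> (0 : R).
  rewrite -[X in _ --> X](mulr0 c); apply: cvgM; first exact: cvg_cst.
  have : (fun k => (2^-1 : R) ^+ k) @ \oo --> (0 : R).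
    by apply: cvg_expr; rewrite ger0_norm ?invr_ge0// invf_lt1// ltr1n.
  by rewrite -(cvg_shiftn n).
have xl : x @ \oo --> limn y.
  rewrite -(cvg_shiftn n) -(addr0 (limn y)).
  have -> : (fun k => x (k + n)%N) = y \+ (fun k => c * 2^-1 ^+ (k + n)).
    by apply/funext => k /=; rewrite /y subrK.
  exact: cvgD.
have -> : limn x = limn y by exact/cvg_lim.
split; first exact: xl.
move=> k nk; rewrite -(subnK nk).
have yl := nondecreasing_cvgn_le ny cy (k - n)%N.
have lz : limn y <= z (k - n)%N.
  by apply: limr_le => //; apply: nearW => j.
by move: yl lz; rewrite /y /z ler_norml => ? ?; apply/andP; split; lra.
Qed.

Definition climn (a : nat -> R[i]) : R[i] :=
  complex.Complex (limn (fun k => Re (a k))) (limn (fun k => Im (a k))).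

Lemma geometric_ccvg (a : nat -> R[i]) c n :
  (forall k, (n <= k)%N -> normc (a k.+1 - a k) <= c * 2^-1 ^+ k.+1) ->
  [/\ Re (a k) @[k --> \oo] --> Re (climn a), Im (a k) @[k --> \oo] --> Im (climn a) &
    forall k, (n <= k)%N -> normc (a k - climn a) <= 2 * c * 2^-1 ^+ k].
Proof.
move=> H.
have [|cr hr] := @geometric_cvg (fun k => Re (a k)) c n.
  by move=> k /H; apply: le_trans; rewrite -ReN -ReD Re_le.
have [|ci hi] := @geometric_cvg (fun k => Im (a k)) c n.
  by move=> k /H; apply: le_trans; rewrite -ImN -ImD Im_le.
split => // k nk; apply: (le_trans (normc_le_ReIm _)).
rewrite ReD ReN ImD ImN /climn/=; have := hr k nk; have := hi k nk; lra.
Qed.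

End Geometric.

(** * The boundary function and the power series *)

Section Boundary.
Context {R : realType}.
Variables (F : nat -> {poly R[i]}) (s : nat -> nat).
Hypothesis Fs : stages F s.

Let f n t := (F n).[expi t].

(** The coefficient of index i is already final in F_(i+1). *)
Definition series_coef i : R[i] := (F i.+1)`_i.

Lemma block_start_ge n : (n <= s n)%N.
Proof. by elim: n => // n IH; exact: leq_ltn_trans IH (refines_lt (stages_refines Fs n)). Qed.

Lemma block_start_mono n m : (n <= m)%N -> (s n <= s m)%N.
Proof.
move=> nm; rewrite -(subnKC nm); elim: (m - n)%N => [|k IH].
  by rewrite addn0.
by rewrite addnS (leq_trans IH)// ltnW//; exact: (refines_lt (stages_refines Fs _)).
Qed.

Lemma coef_stable n m i : (n <= m)%N -> (i < s n)%N -> (F m)`_i = (F n)`_i.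
Proof.
move=> nm i_n; rewrite -(subnKC nm); elim: (m - n)%N => [|k IH].
  by rewrite addn0.
rewrite addnS -IH -[in RHS](refines_take (stages_refines Fs (n + k))) coef_take_poly.
by rewrite (leq_trans i_n)// block_start_mono// leq_addr.
Qed.

Lemma series_coefE n i : (i < s n)%N -> (F n)`_i = series_coef i.
Proof.
move=> i_n; rewrite /series_coef.
have i_i : (i < s i.+1)%N by exact: block_start_ge.
rewrite -(@coef_stable _ (maxn n i.+1) i (leq_maxl _ _) i_n).
by rewrite -(@coef_stable _ (maxn n i.+1) i (leq_maxr _ _) i_i).
Qed.

Lemma partial_sumE n m t : (m <= s n)%N ->
  series (fun i => series_coef i * expi t ^+ i) m = (take_poly m (F n)).[expi t].
Proof.
move=> mn; rewrite seriesEord/= horner_take_poly; apply: eq_bigr => i _.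
by rewrite (@series_coefE n)// (leq_trans _ mn).
Qed.

Lemma level_exists m : (s 0 <= m)%N -> exists n, (s n <= m < s n.+1)%N.
Proof.
move=> m0; have [n [nm Hn]] : exists n, (s n <= m)%N /\
    forall k, (s k <= m)%N -> (k <= n)%N.
  have ex : exists n, (s n <= m)%N by exists 0%N.
  have bd k : (s k <= m)%N -> (k <= m)%N by exact: leq_trans (block_start_ge k).
  by case: (ex_maxnP ex bd) => n nm Hn; exists n.
by exists n; rewrite nm ltnNge; apply/negP => /Hn; rewrite ltnn.
Qed.

Definition stopped n t := (normc (f n t) <= stop_level n).
(** The stages, replaced by the constant 1/2 as long as t is not stopped: this
    sequence converges at every t, so that no exceptional set has to be
    carried along. *)
Definition frozen n t : R[i] := if stopped n t then f n t else (2^-1)%:C.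

Lemma frozen_le n t : normc (frozen n t) <= 2^-1 + step0.
Proof.
rewrite /frozen; case: ifP => [/le_trans|_]; last first.
  by rewrite normc_real ger0_norm ?invr_ge0// lerDl ltW// step0_gt0.
by apply; rewrite /stop_level lerD2l drift_le.
Qed.

Lemma frozen_ge n t : 2^-1 - 3 * step0 <= normc (frozen n t).
Proof.
rewrite /frozen; case: ifP => [_|_]; first exact: (stages_ge Fs).
by rewrite normc_real ger0_norm ?invr_ge0//; have := @step0_gt0 R; lra.
Qed.

Lemma eventually_stopped t : exists n, forall k, (n <= k)%N ->
  stopped k t = stopped n t.
Proof.
have [[n st]|nst] := pselect (exists n, stopped n t).
  exists n => k nk; rewrite st; exact: (stop_forever Fs nk).
exists 0%N => k _; transitivity false.
  by apply/negP => st; apply: nst; exists k.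
by apply/esym/negP => st; apply: nst; exists 0%N.
Qed.

Lemma frozen_step t : exists n, forall k, (n <= k)%N ->
  normc (frozen k.+1 t - frozen k t) <= step0 * 2^-1 ^+ k.+1.
Proof.
have [n Hn] := eventually_stopped t; exists n => k nk.
rewrite /frozen (Hn _ nk) (Hn k.+1 (leqW nk)); case: ifP => st.
  by apply: (stopped_step Fs); rewrite -/(stopped _ _) Hn.
by rewrite subrr normc0 mulr_ge0 ?exprn_ge0 ?invr_ge0// ltW// step0_gt0.
Qed.

Definition boundary t : R[i] := climn (fun n => frozen n t).

Lemma boundary_cvg t : [/\ Re (frozen n t) @[n --> \oo] --> Re (boundary t),
  Im (frozen n t) @[n --> \oo] --> Im (boundary t) &
  exists n, forall k, (n <= k)%N ->
    normc (frozen k t - boundary t) <= 2 * step0 * 2^-1 ^+ k].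
Proof.
have [n /geometric_ccvg[cr ci h]] := frozen_step t.
by split => //; exists n.
Qed.

Lemma boundary_near t : exists n,
  normc (frozen n t - boundary t) <= 2 * step0.
Proof.
have [_ _ [n /(_ n (leqnn n)) h]] := boundary_cvg t; exists n.
apply: (le_trans h); rewrite ler_piMr ?half_le1//.
by rewrite mulr_ge0// ltW// step0_gt0.
Qed.

Lemma boundary_le t : normc (boundary t) <= 2^-1 + 3 * step0.
Proof.
have [n h] := boundary_near t; have := frozen_le n t.
have := ler_normcB (boundary t) (boundary t - frozen n t).
by rewrite subKr normcBC; lra.
Qed.

Lemma boundary_ge t : 2^-1 - 5 * step0 <= normc (boundary t).
Proof.
have [n h] := boundary_near t; have := frozen_ge n t.
have := ler_normcB (frozen n t) (frozen n t - boundary t).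
by rewrite subKr; lra.
Qed.

Lemma boundary_periodic : periodic boundary (2 * pi).
Proof.
move=> t; congr climn; apply/funext => n.
by rewrite /frozen /stopped /f expi_periodic.
Qed.

(** At a stopped point the partial sums between two stages differ from the
    stage by at most its tolerance. *)
Lemma stopped_series_cvg n t : stopped n t ->
  power_series_cvg series_coef (expi t) (boundary t).
Proof.
move=> st.
have stk k : (n <= k)%N -> stopped k t by move=> nk; exact: (stop_forever Fs nk).
have [_ _ [n1 Hn1]] := boundary_cvg t.
have close m k : (n <= k)%N -> (n1 <= k)%N -> (s k <= m)%N ->
    normc (boundary t - series (fun i => series_coef i * expi t ^+ i) m)
      <= 3 * step0 * 2^-1 ^+ k.
  move=> nk n1k km.
  have [l /andP[lm ml]] := level_exists (leq_trans (block_start_mono (leq0n k)) km).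
  have kl : (k <= l)%N.
    rewrite leqNgt; apply/negP => lk.
    by have := leq_ltn_trans (leq_trans (block_start_mono lk) km) ml; rewrite ltnn.
  have sl := stk l (leq_trans nk kl).
  rewrite (partial_sumE t (ltnW ml)).
  have h1 := refines_stop (stages_refines Fs _) lm sl.
  have := Hn1 l (leq_trans n1k kl); rewrite /frozen sl => h2.
  have := ler_normcD (boundary t - f l t) (f l t - (take_poly m (F l.+1)).[expi t]).
  rewrite addrA subrK (normcBC (boundary t) (f l t)) (normcBC (f l t) (take_poly _ _).[_]) => h3.
  have r0 := @step0_gt0 R.
  have hl : step0 * 2^-1 ^+ l <= step0 * 2^-1 ^+ k :> R.
    by rewrite ler_pM2l// ler_wiXn2l ?invr_ge0// invf_le1// ler1n.
  have : tolerance l <= step0 * 2^-1 ^+ l :> R.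
    by rewrite /tolerance exprS ler_pM2l// ler_piMl ?half_ge0// invf_le1// ler1n.
  by move: h1 h2 h3; rewrite /f; lra.
rewrite /power_series_cvg. apply/(@cvgrPdist_le R[i] R[i]^o) => /= e e0.
have [re_gt0 eE] : 0 < Re e /\ e = (Re e)%:C.
  by move: e0; case: e => a b; rewrite ltcE/= => /andP[/eqP -> ->].
have [k Hk] : exists k, 2^-1 ^+ k <= Re e / (3 * step0) :> R.
  apply: expr_le_eps; last by rewrite divr_gt0// mulr_gt0// step0_gt0.
  by rewrite invr_ge0 ler0n/= invf_lt1// ltr1n.
pose k' := maxn k (maxn n n1).
exists (s k') => // m /= km.
have := close m k'; rewrite !leq_max !leqnn !orbT => /(_ isT isT km) h.
have -> : `|boundary t - series (fun n0 => series_coef n0 * expi t ^+ n0) m| =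
  (normc (boundary t - series (fun n0 => series_coef n0 * expi t ^+ n0) m))%:C by [].
rewrite eE lecR (le_trans h)//.
have : 2^-1 ^+ k' <= 2^-1 ^+ k :> R.
  by rewrite ler_wiXn2l ?invr_ge0// ?invf_le1 ?ler1n// leq_maxl.
move=> /le_trans/(_ Hk); rewrite ler_pdivlMr; last by rewrite mulr_gt0// step0_gt0.
by rewrite mulrC.
Qed.

End Boundary.

(** * The boundary function is in L^2 and not in H^2 *)

Section NotHardy.
Context {R : realType}.
Variables (F : nat -> {poly R[i]}) (s : nat -> nat).
Hypothesis Fs : stages F s.

Let f n t := (F n).[expi t].
Let b := boundary F.
Let mu := @lebesgue_measure R.

Lemma measurable_stopped n : measurable_fun setT (stopped F n).
Proof.
apply: measurable_fun_ler => //.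
by apply: continuous_measurable_fun; exact: continuous_normc_expi.
Qed.

Lemma measurable_if_stopped n (g h : R -> R) : continuous g -> continuous h ->
  measurable_fun setT (fun t => if stopped F n t then g t else h t).
Proof.
move=> cg ch; apply: measurable_fun_ifT; first exact: measurable_stopped.
  exact: continuous_measurable_fun.
exact: continuous_measurable_fun.
Qed.

Lemma measurable_boundary_Re : measurable_fun setT (fun t => Re (b t)).
Proof.
apply: (@measurable_fun_cvg _ _ _ _ (fun n t => Re (frozen F n t))); last first.
  by move=> t _; have [] := boundary_cvg Fs t.
move=> n; rewrite /frozen.
under eq_fun do rewrite (fun_if (@Re R)).
by apply: measurable_if_stopped; [have [] := stage_cont F n|exact: cont_cst].
Qed.

Lemma measurable_boundary_Im : measurable_fun setT (fun t => Im (b t)).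
Proof.
apply: (@measurable_fun_cvg _ _ _ _ (fun n t => Im (frozen F n t))); last first.
  by move=> t _; have [] := boundary_cvg Fs t.
move=> n; rewrite /frozen.
under eq_fun do rewrite (fun_if (@Im R)).
by apply: measurable_if_stopped; [have [] := stage_cont F n|exact: cont_cst].
Qed.

Lemma boundary_L2 : L2_circle b.
Proof.
split.
- exact: boundary_periodic.
- exact: measurable_funS measurable_boundary_Re.
- exact: measurable_funS measurable_boundary_Im.
have mN : measurable_fun setT (fun t => normc (b t) ^+ 2).
  under eq_fun do rewrite normc_sqr.
  apply: measurable_funD; apply: measurable_funX.
    exact: measurable_boundary_Re.
  exact: measurable_boundary_Im.
have : circle_integrable (fun t => normc (b t) ^+ 2).
  apply: (@bounded_integrable _ _ 1) => // t.
  rewrite ger0_norm ?sqr_ge0// exprn_ile1 ?normc_ge0//.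
  by have := boundary_le Fs t; have := @step0E R; rewrite -/b; lra.
move=> /integrableP[_]; apply: le_lt_trans.
rewrite le_eqVlt; apply/orP; left; apply/eqP.
by apply: eq_integral => t _ /=; rewrite ger0_norm ?sqr_ge0.
Qed.

Lemma never_stopped_null : mu.-negligible
  [set t | 0 <= t < 2 * pi /\ forall n, ~~ stopped F n t].
Proof.
pose A n : set R := [set t | stop_level n < normc (f n t)].
pose E n : set R := A n `&` `[0, 2 * pi].
have mA n : measurable (A n).
  have -> : A n = setT `&` (stopped F n) @^-1` [set false].
    rewrite setTI; apply/seteqP; split => t /=.
      by rewrite /A /= /stopped ltNge => /negbTE.
    by rewrite /A /= /stopped ltNge => ->.
  exact: measurable_stopped.
have mE n : measurable (E n) by exact: measurableI.
exists (\bigcap_n E n); split.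
- exact: bigcapT_measurable.
- apply/eqP; rewrite eq_le measure_ge0 andbT; apply/lee_addgt0Pr => e e0.
  rewrite add0e; have [n an] := active_small Fs e0.
  apply: (@le_trans _ _ (mu (E n))).
    apply: le_measure; rewrite ?inE; [exact: bigcapT_measurable|exact: mE|].
    by move=> t /(_ n I).
  have -> : (mu (E n) = (circle_int (active F n))%:E)%E.
    rewrite /circle_int /Rintegral fineK; last first.
      by apply: integrable_fin_num => //; exact: integrable_above.
    transitivity (\int[mu]_(t in `[0%R, (2 * pi)%R]) (\1_(A n) t)%:E)%E.
      by rewrite integral_indic //; exact: mA.
    apply: eq_integral => t _.
    by rewrite /active /above indicE mem_setE.
  by rewrite lee_fin.
- move=> t /= [t02 nst] n _; split => /=.
    by have := nst n; rewrite /stopped -ltNge.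
  by rewrite in_itv/=; case/andP: t02 => -> /ltW.
Qed.

Lemma series_cvg_ae : {ae mu, forall t : R,
   0 <= t < 2 * pi -> power_series_cvg (series_coef F) (expi t) (b t)}.
Proof.
apply: negligibleS never_stopped_null => t /=.
move=> /not_implyP[t02 ncv]; split => // n; apply/negP => st.
by apply: ncv; exact: (stopped_series_cvg Fs st).
Qed.

Lemma frozen_neq0 n t : frozen F n t != 0.
Proof. by rewrite -normc_gt0; have := frozen_ge Fs n t; have := @step0E R; lra. Qed.

Lemma boundary_neq0 t : b t != 0.
Proof. by rewrite -normc_gt0; have := boundary_ge Fs t; have := @step0E R; rewrite -/b; lra. Qed.

Let frozen_pairing n t := Re (conjc (expi t) / frozen F n t).
Let boundary_pairing t := Re (conjc (expi t) / b t).

Lemma frozen_pairing_cvg t : frozen_pairing n t @[n --> \oo] --> boundary_pairing t.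
Proof.
have [_ _ [n0 H]] := boundary_cvg Fs t.
have r0 := @step0_gt0 R; have rE := @step0E R.
apply/cvgrPdist_le => e e0.
have [k Hk] : exists k, 2^-1 ^+ k <= e / (20 * step0) :> R.
  apply: expr_le_eps; last by rewrite divr_gt0// mulr_gt0.
  by rewrite invr_ge0 ler0n/= invf_lt1// ltr1n.
exists (maxn n0 k) => // n /=; rewrite geq_max => /andP[n0n kn].
rewrite /boundary_pairing /frozen_pairing -ReN -ReD (le_trans (Re_le _))// -mulrBr normcM normc_conj normc_expi.
have bn0 := boundary_neq0 t; have fn0 := frozen_neq0 n t.
have -> : (b t)^-1 - (frozen F n t)^-1 =
    (frozen F n t - b t) * ((b t)^-1 * (frozen F n t)^-1).
  by rewrite mulrBl mulrCA divff// mulr1 mulrA divff// mul1r.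
have bb : (normc (b t))^-1 <= 3.
  rewrite -[leRHS]invrK lef_pV2 ?posrE ?normc_gt0//.
  by have := boundary_ge Fs t; rewrite -/b; lra.
have ff : (normc (frozen F n t))^-1 <= 3.
  rewrite -[leRHS]invrK lef_pV2 ?posrE ?normc_gt0//.
  by have := frozen_ge Fs n t; lra.
rewrite mul1r normcM [normc (_^-1 * _)]normcM !normcV.
have h9 : (normc (b t))^-1 * (normc (frozen F n t))^-1 <= 3 * 3.
  by rewrite ler_pM// invr_ge0 normc_ge0.
have hk : 2^-1 ^+ n <= 2^-1 ^+ k :> R.
  by rewrite ler_wiXn2l ?invr_ge0// ?invf_le1 ?ler1n.
have := H n n0n; rewrite -/b => hn.
have hX : 2^-1 ^+ n * (20 * step0) <= e.
  by rewrite -ler_pdivlMr ?mulr_gt0// (le_trans hk).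
apply: (@le_trans _ _ (2 * step0 * 2^-1 ^+ n * (3 * 3))); last by lra.
by apply: ler_pM => //; rewrite ?mulr_ge0 ?invr_ge0 ?normc_ge0.
Qed.

Lemma frozen_pairing_bound n t : `|frozen_pairing n t| <= 3.
Proof.
rewrite (le_trans (Re_le _))// normcM normc_conj normc_expi mul1r normcV.
rewrite -[leRHS]invrK lef_pV2 ?posrE ?normc_gt0 ?frozen_neq0//.
by have := frozen_ge Fs n t; have := @step0E R; lra.
Qed.

Lemma cont_stage_pairing n : continuous (fun t => Re (conjc (expi t) / f n t)).
Proof.
have [] // : ccont (fun t => conjc (expi t) / f n t).
apply: ccontM; first by apply: ccont_conj; exact: ccont_expi.
by apply: ccontV; [exact: stage_cont|exact: stage_neq0 Fs n].
Qed.

Lemma measurable_frozen_pairing n : measurable_fun setT (frozen_pairing n).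
Proof.
have -> : frozen_pairing n = (fun t => if stopped F n t then Re (conjc (expi t) / f n t)
    else Re (conjc (expi t) / (2^-1)%:C)).
  by apply/funext => t; rewrite /frozen_pairing /frozen; case: ifP.
apply: measurable_if_stopped; first exact: cont_stage_pairing.
have [] // : ccont (fun t : R => conjc (expi t) / (2^-1)%:C).
apply: ccontM; last exact: ccont_cst.
by apply: ccont_conj; exact: ccont_expi.
Qed.

(** On stopped points the two integrands agree, and elsewhere each of them is
    at most 3. *)
Lemma frozen_pairing_le n : circle_int (frozen_pairing n) <=
  circle_int (fun t => Re (conjc (expi t) / f n t)) + 6 * circle_int (active F n).
Proof.
have ia := integrable_above (stop_level n) (F n).
have ih := cont_integrable (@cont_stage_pairing n).
rewrite -circle_intZ// -circle_intD//; last exact: integrable_scale.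
apply: le_circle_int.
- by apply: bounded_integrable; [exact: measurable_frozen_pairing|exact: frozen_pairing_bound].
- by apply: integrable_add => //; exact: integrable_scale.
move=> t; have := frozen_pairing_bound n t; rewrite /frozen_pairing /frozen /active /above /stopped -/(f n t).
case: leP => _; first by rewrite mulr0 addr0.
rewrite mulr1 ler_norml => /andP[_ h].
have : `|Re (conjc (expi t) / f n t)| <= 3.
  rewrite (le_trans (Re_le _))// normcM normc_conj normc_expi mul1r normcV.
  rewrite -[leRHS]invrK lef_pV2 ?posrE ?normc_gt0 ?(stage_neq0 Fs)//.
  by have := stage_ge Fs n t; rewrite -/(f n t); lra.
rewrite ler_norml => /andP[h' _]; lra.
Qed.

(** The expansion e^(-it) / (1 + u) = e^(-it) (1 - u) + e^(-it) u^2 / (1 + u),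
    with u = e^(it) / 4, has mean -1/4 up to 1/12. *)
Lemma start_mean : circle_int (fun t => Re (conjc (expi t) / f 0 t))
  <= - (1 / 6) * (2 * pi).
Proof.
have cc : continuous (fun t : R => cos (t *+ 1)) by exact: continuous_cos.
have c0 : circle_int (fun t : R => cos (t *+ 1) + - (1 / 6)) = - (1 / 6) * (2 * pi).
  rewrite circle_intD ?circle_int_cst; [|exact: cont_integrable|exact: integrable_cst].
  by rewrite circle_int_cos add0r.
rewrite -c0; apply: le_circle_int.
- apply: cont_integrable; exact: cont_stage_pairing.
- by apply: cont_integrable; apply: contD => //; exact: cont_cst.
move=> t; have fE : f 0 t = 1 + (4^-1)%:C * expi t.
  by rewrite /f (stages_start Fs) horner_start_poly.
pose u := (4^-1)%:C * expi t.
have nu : normc u = 4^-1 by rewrite normcM normc_real normc_expi mulr1 ger0_norm ?invr_ge0.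
have f34 : 3 / 4 <= normc (1 + u).
  by rewrite -fE /f (stages_start Fs) start_poly_ge.
have fn0 : 1 + u != 0 by rewrite -normc_gt0; lra.
have E : conjc (expi t) / f 0 t = conjc (expi t) - (4^-1)%:C
    + conjc (expi t) * (u ^+ 2 / (1 + u)).
  rewrite fE -/u.
  have -> : (4^-1)%:C = conjc (expi t) * u.
    by rewrite /u mulrCA expi_conjM mulr1.
  by field.
have small : `|Re (conjc (expi t) * (u ^+ 2 / (1 + u)))| <= 1 / 12.
  rewrite (le_trans (Re_le _))// normcM normc_conj normc_expi mul1r.
  rewrite normcM normcX nu normcV ler_pdivrMr; last lra.
  by rewrite expr2; lra.
rewrite E ReD ReD ReN Re_conjc mulr1n.
move: small; set W := Re (_ * (_ / _)); rewrite ler_norml => /andP[_ hW].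
rewrite /=; lra.
Qed.

(** The coefficient of index 1 of 1/f, more precisely the real part of the
    integral of e^(-it) / f, stays negative in the limit: it starts below - 2
    pi / 6 and the errors of all stages are much smaller. *)
Lemma boundary_mean : circle_int boundary_pairing <= - (1 / 10) * (2 * pi).
Proof.
have pi1 : 1 <= pi :> R by have := @pi_ge2 R; lra.
have r0 := @step0_gt0 R; have rE := @step0E R.
have gc : circle_int (frozen_pairing n) @[n --> \oo] --> circle_int boundary_pairing.
  apply: (@circle_int_cvg _ _ _ 3); [exact: measurable_frozen_pairing|exact: frozen_pairing_bound|exact: frozen_pairing_cvg].
have [n0 Hn0] := active_small Fs r0.
have /cvgrPdist_le /(_ _ r0) [n1 _ Hn1] := gc.
pose n := maxn n0 n1.
have := Hn1 n (leq_maxr _ _); rewrite ler_norml => /andP[_ h1].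
have h2 := frozen_pairing_le n.
have h3 : circle_int (active F n) <= step0.
  by apply: le_trans Hn0; apply: (active_decr Fs); exact: leq_maxl.
have := mean_coef Fs n; rewrite ler_norml => /andP[_ h4].
have h5 := start_mean.
have r3 : step0 ^+ 3 <= step0 * (1 / 1000) * (1 / 1000) :> R.
  have -> : 1 / 1000 = step0 :> R by lra.
  by rewrite !exprS expr0 mulr1 mulrA.
have h6 : 320 * (3 * step0 ^+ 3) * (2 * pi) <= 320 * (3 * (step0 * (1 / 1000) * (1 / 1000))) * (2 * pi) :> R.
  have : 0 <= (step0 * (1 / 1000) * (1 / 1000) - step0 ^+ 3) * (2 * pi) :> R.
    by apply: mulr_ge0; [rewrite subr_ge0|lra].
  lra.
have h7 : step0 * pi <= 1 / 1000 * pi :> R by rewrite ler_pM2r//; lra.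
rewrite /f in h2 h5.
lra.
Qed.

(** If f were in H^2, the real part of f e^(it) would have mean 0.  It equals
    |f|^2 times the real part of e^(-it) / f, where |f|^2 is nearly 1/4, so
    the mean just estimated would be nearly 0. *)
Lemma boundary_not_hardy : ~ hardy2 b.
Proof.
move=> [_ /(_ 1%N isT)]; rewrite /fourier_coef => /eqP; rewrite mulf_eq0.
have pi0 := @pi2_gt0 R; have r0 := @step0_gt0 R; have rE := @step0E R.
have -> /= : (((2 * pi)^-1)%:C == 0 :> R[i]) = false.
  by rewrite -normc_eq0 normc_real normr_eq0 invr_eq0 gt_eqF.
rewrite /cintegral eq_complex/= => /andP[/eqP + _].
pose h t := Re (b t * expi t).
have -> : (fun t : R => Re (b t * expi (- ((- 1)%:~R * t)))) = h.
  by apply/funext => t; rewrite /h; congr (Re (_ * expi _)); rewrite mulrN1z mulN1r opprK.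
rewrite -/(circle_int h) => h0.
have hg t : boundary_pairing t = (normc (b t) ^+ 2)^-1 * h t.
  have E : conjc (expi t) / b t = conjc (((normc (b t) ^+ 2)^-1)%:C * (b t * expi t)).
    rewrite invc_conj ?boundary_neq0//.
    have conjM (y z : R[i]) : conjc (y * z) = conjc y * conjc z by exact: rmorphM.
    by rewrite !conjM conjc_real; ring.
  by rewrite /boundary_pairing E Re_conjc ReM/= mul0r subr0.
have mh : measurable_fun setT h.
  rewrite /h; under eq_fun do rewrite ReM.
  apply: measurable_funB; apply: measurable_funM.
  - exact: measurable_boundary_Re.
  - by apply: continuous_measurable_fun; exact: continuous_cos.
  - exact: measurable_boundary_Im.
  - by apply: continuous_measurable_fun; exact: continuous_sin.
have hb t : `|h t| <= normc (b t).
  by rewrite (le_trans (Re_le _))// normcM normc_expi mulr1.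
have ih : circle_integrable h.
  apply: (@bounded_integrable _ _ 1) => // t; rewrite (le_trans (hb t))//.
  by have := boundary_le Fs t; rewrite -/b; lra.
have mg : measurable_fun setT boundary_pairing.
  by apply: (@measurable_fun_cvg _ _ _ _ frozen_pairing) => [n|t _]; [exact: measurable_frozen_pairing|exact: frozen_pairing_cvg].
have ig : circle_integrable boundary_pairing.
  apply: (@bounded_integrable _ _ 3) => // t.
  rewrite (le_trans (Re_le _))// normcM normc_conj normc_expi mul1r normcV.
  rewrite -[leRHS]invrK lef_pV2 ?posrE ?normc_gt0 ?boundary_neq0//.
  by have := boundary_ge Fs t; rewrite -/b; lra.
have : `|circle_int (fun t => 4^-1 * boundary_pairing t) - circle_int h| <= 11 * step0 * (2 * pi).
  apply: circle_int_close => //; first exact: integrable_scale.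
  move=> t; rewrite hg; have := boundary_le Fs t; have := boundary_ge Fs t; rewrite -/b.
  have := hb t; have : 0 < normc (b t) by rewrite normc_gt0 boundary_neq0.
  move: (normc (b t)) (h t) => N H N0 HN Nge Nle.
  have -> : 4^-1 * ((N ^+ 2)^-1 * H) - H = H * (((4 * N ^+ 2)^-1) - 1).
    by field; lra.
  have -> : (4 * N ^+ 2)^-1 - 1 = (2^-1 - N) * (2^-1 + N) / N ^+ 2.
    by field; lra.
  rewrite normrM (le_trans (ler_wpM2r _ HN))// normrM normfV.
  rewrite (ger0_norm (sqr_ge0 N)).
  have -> : N * (`|(2^-1 - N) * (2^-1 + N)| / N ^+ 2) =
    `|(2^-1 - N) * (2^-1 + N)| / N by field; lra.
  rewrite ler_pdivrMr// normrM.
  have hm : `|2^-1 - N| <= 5 * step0 by rewrite ler_norml; apply/andP; split; lra.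
  have hp : `|2^-1 + N| <= 101 / 100 by rewrite ler_norml; apply/andP; split; lra.
  have := ler_pM (normr_ge0 _) (normr_ge0 _) hm hp.
  have : 11 * step0 * (49 / 100) <= 11 * step0 * N.
    by rewrite ler_wpM2l ?mulr_ge0// ?(ltW r0)//; lra.
  lra.
rewrite circle_intZ// h0 subr0 ler_norml => /andP[h1 _].
have := boundary_mean => h2.
have h3 : step0 * pi = 1 / 1000 * pi :> R by congr (_ * _); lra.
have := @pi_gt0 R; lra.
Qed.

End NotHardy.

Theorem theorem2 (R : realType) :
  exists (c : nat -> R[i]) (f : R -> R[i]),
    [/\ L2_circle f,
        {ae @lebesgue_measure R, forall t : R,
           0 <= t < 2 * pi -> power_series_cvg c (expi t) (f t)} &
        ~ hardy2 f].
Proof.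
have [F [s Fs]] := @stages_exist R.
exists (series_coef F), (boundary F); split.
- exact: boundary_L2 Fs.
- exact: series_cvg_ae Fs.
- exact: boundary_not_hardy Fs.
Qed.
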